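(* Let $\mathscr{V}$ be a Hilbert $\mathscr{A}$-module over a $C^*$-algebra $\mathscr{A}$, and let $\Omega$ denote the numerical radius on $\mathscr{V}$, as defined in the context. Then $\Omega(\cdot)$ is a norm on $\mathscr{V}$, and for every $x\in\mathscr{V}$ $$\frac{1}{2}\|x\|\le \Omega(x)\le \|x\|.$$
   Context: $\mathscr{A}$ is a nonzero (not necessarily unital) complex $C^*$-algebra. A Hilbert $\mathscr{A}$-module $\mathscr{V}$ is a right $\mathscr{A}$-module with an $\mathscr{A}$-valued inner product $\langle\cdot,\cdot\rangle$ that is $\mathbb{C}$-linear and $\mathscr{A}$-linear in the second variable, so that $\langle x, ya\rangle=\langle x,y\rangle a$, and that satisfies $\langle x,y\rangle^*=\langle y,x\rangle$ and $\langle x,x\rangle\ge 0$ with equality iff $x=0$. It is complete in the norm $\|x\|=\|\langle x,x\rangle\|^{1/2}$. $\mathscr{A}$ is a Hilbert module over itself with $\langle a,b\rangle=a^*b$. For Hilbert $\mathscr{A}$-modules $\mathscr{V},\mathscr{W}$, $\mathbb{B}(\mathscr{V},\mathscr{W})$ is the space of adjointable maps and $\mathbb{K}(\mathscr{V},\mathscr{W})$ is the closed linear span in it of the maps $\theta_{x,y}(z)=x\langle y,z\rangle$ ($x\in\mathscr{W}$, $y\in\mathscr{V}$); $\mathbb{K}(\mathscr{V})=\mathbb{K}(\mathscr{V},\mathscr{V})$. For $a\in\mathscr{A}$ let $T_a\in\mathbb{K}(\mathscr{A})$ be $T_a(b)=ab$. For $x\in\mathscr{V}$ let $r_x\in\mathbb{K}(\mathscr{A},\mathscr{V})$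 be $r_x(a)=xa$ and $l_x\in\mathbb{K}(\mathscr{V},\mathscr{A})$ be $l_x(y)=\langle x,y\rangle$, so $r_x^*=l_x$. The linking algebra of $\mathscr{V}$ is the $C^*$-algebra $\mathbb{L}(\mathscr{V})=\left\{\begin{bmatrix} T_a & l_y\\ r_x & T\end{bmatrix}: a\in\mathscr{A},\ x,y\in\mathscr{V},\ T\in\mathbb{K}(\mathscr{V})\right\}=\mathbb{K}(\mathscr{A}\oplus\mathscr{V})$, acting on $\mathscr{A}\oplus\mathscr{V}$ by matrix multiplication on column vectors, with the operator norm. $\mathcal{S}(\mathbb{L}(\mathscr{V}))$ is the set of states (positive linear functionals of norm $1$) of $\mathbb{L}(\mathscr{V})$. The numerical radius of $x\in\mathscr{V}$ is $\Omega(x)=\sup\left\{\left|\varphi\left(\begin{bmatrix}0&0\\ r_x&0\end{bmatrix}\right)\right|:\varphi\in\mathcal{S}(\mathbb{L}(\mathscr{V}))\right\}$. *)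

(* Defs.v *)
From HB Require Import structures.
From mathcomp Require Import all_boot all_order all_algebra.
From mathcomp Require Import complex.
From mathcomp Require Import all_classical all_reals all_analysis.
Set Implicit Arguments.
Unset Strict Implicit.
Unset Printing Implicit Defensive.
Import Order.TTheory GRing.Theory Num.Theory.
Import numFieldNormedType.Exports.
Local Open Scope classical_set_scope.
Local Open Scope ring_scope.

(* The library norm of a normed space over R[i] takes its values in R[i] (on
   the nonnegative reals); [nrm] is the same norm with values in R. On R[i]
   itself it is the modulus. *)
Definition nrm (R : realType) (V : normedZmodType R[i]) (x : V) : R :=
  complex.Re `|x|.

(* No unit is required, hence a product that is independent of the (unital)
   ring structures of the algebraic hierarchy. *)
HB.mixin Record isCStarAlgebra (R : realType) A
    of CompleteNormedModule R[i] A := {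
  cmul : A -> A -> A;
  star : A -> A;
  cmulA : associative cmul;
  cmulDl : left_distributive cmul +%R;
  cmulDr : right_distributive cmul +%R;
  cmulZl : forall (c : R[i]) (a b : A), cmul (c *: a) b = c *: cmul a b;
  cmulZr : forall (c : R[i]) (a b : A), cmul a (c *: b) = c *: cmul a b;
  starD : {morph star : a b / a + b};
  starZ : forall (c : R[i]) (a : A), star (c *: a) = Num.conj c *: star a;
  starM : forall a b : A, star (cmul a b) = cmul (star b) (star a);
  starK : involutive star;
  cnormM : forall a b : A, `|cmul a b| <= `|a| * `|b|;
  cstar_identity : forall a : A, `|cmul (star a) a| = `|a| ^+ 2
}.

#[short(type="cstarAlgType")]
HB.structure Definition CStarAlgebra (R : realType) :=
  {A of isCStarAlgebra R A & CompleteNormedModule R[i] A}.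

Definition cstar_pos (R : realType) (A : cstarAlgType R) (a : A) : Prop :=
  exists b : A, a = cmul (star b) b.

HB.mixin Record isHilbertModule (R : realType) (A : cstarAlgType R) V
    of CompleteNormedModule R[i] V := {
  act : V -> A -> V;
  inner : V -> V -> A;
  actDl : forall (x y : V) (a : A), act (x + y) a = act x a + act y a;
  actDr : forall (x : V) (a b : A), act x (a + b) = act x a + act x b;
  actM : forall (x : V) (a b : A), act x (cmul a b) = act (act x a) b;
  actZl : forall (c : R[i]) (x : V) (a : A), act (c *: x) a = c *: act x a;
  actZr : forall (c : R[i]) (x : V) (a : A), act x (c *: a) = c *: act x a;
  innerDr : forall x y z : V, inner x (y + z) = inner x y + inner x z;
  innerZr : forall (c : R[i]) (x y : V), inner x (c *: y) = c *: inner x y;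
  inner_act : forall (x y : V) (a : A), inner x (act y a) = cmul (inner x y) a;
  inner_star : forall x y : V, star (inner x y) = inner y x;
  inner_pos : forall x : V, cstar_pos (inner x x);
  inner_eq0 : forall x : V, inner x x = 0 <-> x = 0;
  hnormE : forall x : V, `|x| = sqrtC `|inner x x|
}.

#[short(type="hilbertModType")]
HB.structure Definition HilbertModule (R : realType) (A : cstarAlgType R) :=
  {V of isHilbertModule R A V & CompleteNormedModule R[i] V}.

(* +oo when T is unbounded. *)
Definition opnorm (R : realType) (E F : Type) (nE : E -> R) (nF : F -> R)
    (T : E -> F) : \bar R :=
  ereal_sup [set (nF (T z))%:E | z in [set z | nE z <= 1]].

Section Operators.
Variables (R : realType) (A : cstarAlgType R) (V W : hilbertModType A).

Definition adjointable (T : V -> W) : Prop :=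
  exists S : W -> V, forall x y, inner (T x) y = inner x (S y).

Definition theta (x : W) (y : V) : V -> W := fun z => act x (inner y z).

Definition theta_span (S : V -> W) : Prop :=
  exists (n : nat) (c : 'I_n -> R[i]) (x : 'I_n -> W) (y : 'I_n -> V),
    forall z, S z = \sum_(i < n) c i *: theta (x i) (y i) z.

Definition compact_op (T : V -> W) : Prop :=
  adjointable T /\
  forall e : R, 0 < e -> exists2 S : V -> W, theta_span S &
    (opnorm (@nrm R V) (@nrm R W) (fun z => T z - S z)%R < e%:E)%E.

End Operators.

Section LinkingAlgebra.
Variables (R : realType) (A : cstarAlgType R) (V : hilbertModType A).

(* The Hilbert A-module A (+) V. Its norm is the one given by its inner
   product, not the max norm that the library puts on products. *)
Definition dsum_inner (z w : A * V) : A :=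
  cmul (star z.1) w.1 + inner z.2 w.2.

Definition dsum_norm (z : A * V) : R := Num.sqrt (nrm (dsum_inner z z)).

Definition Tmap (a : A) : A -> A := fun b => cmul a b.
Definition rmap (x : V) : A -> V := fun a => act x a.
Definition lmap (x : V) : V -> A := fun y => inner x y.

Definition blockop (T11 : A -> A) (T12 : V -> A) (T21 : A -> V) (T22 : V -> V)
    : A * V -> A * V :=
  fun z => (T11 z.1 + T12 z.2, T21 z.1 + T22 z.2).

Definition linking : set (A * V -> A * V) :=
  [set M | exists a x y T,
     compact_op T /\ M = blockop (Tmap a) (lmap y) (rmap x) T].

Definition linking_norm (M : A * V -> A * V) : \bar R :=
  opnorm dsum_norm dsum_norm M.

Definition dsum_adjoint (M N : A * V -> A * V) : Prop :=
  forall z w, dsum_inner (M z) w = dsum_inner z (N w).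

(* A functional on the linking algebra is represented by a function on all maps
   A * V -> A * V, of which only the values on [linking] matter. *)
Definition linking_linear (phi : (A * V -> A * V) -> R[i]) : Prop :=
  forall (c : R[i]) M N, linking M -> linking N ->
    phi (fun z => c *: M z + N z) = c * phi M + phi N.

(* The positive elements of the linking algebra are the products M^* M. *)
Definition linking_positive (phi : (A * V -> A * V) -> R[i]) : Prop :=
  forall M Mstar, linking M -> linking Mstar -> dsum_adjoint M Mstar ->
    0 <= phi (Mstar \o M).

Definition functional_norm (phi : (A * V -> A * V) -> R[i]) : \bar R :=
  ereal_sup [set (nrm (phi M))%:E |
    M in [set M | linking M /\ (linking_norm M <= 1%:E)%E]].

Definition linking_state : set ((A * V -> A * V) -> R[i]) :=
  [set phi | [/\ linking_linear phi, linking_positive phi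
               & functional_norm phi = 1%:E]].

Definition numradius (x : V) : R :=
  sup [set nrm (phi (blockop (fun=> 0) (fun=> 0) (rmap x) (fun=> 0))) |
    phi in linking_state].

End LinkingAlgebra.

Definition is_norm (R : realType) (V : lmodType R[i]) (N : V -> R) : Prop :=
  [/\ forall x, 0 <= N x,
      forall x, N x = 0 <-> x = 0,
      forall (c : R[i]) x, N (c *: x) = nrm c * N x
    & forall x y, N (x + y) <= N x + N y].

(* Main.v *)
Require Import Defs.
From HB Require Import structures.
From mathcomp Require Import all_boot all_order all_algebra.
From mathcomp Require Import complex.
From mathcomp Require Import all_classical all_reals all_analysis.
From mathcomp Require Import ring lra.
Set Implicit Arguments.
Unset Strict Implicit.
Unset Printing Implicit Defensive.
Import Order.TTheory GRing.Theory Num.Theory.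
Import numFieldNormedType.Exports.
Local Open Scope classical_set_scope.
Local Open Scope complex_scope.
Local Open Scope ring_scope.

(* The upper bound needs only that the corner operator of x maps (a, v) to
   (0, x a), together with |a| <= |(a, v)|, i.e. monotonicity of the norm on
   positive elements: |a^* a| <= |a^* a + b^* b|. For the lower bound one may take
   |x| = 1. With h = <x, x> choose a contractive positive functional rho on A
   attaining the norm of <x h, x h>, and let z = (h, x h) / sqrt 2. Then
   M |-> rho <z, M z> is a positive functional of norm at most 1 on the linking
   algebra whose value at the corner operator of x is 1/2, and dividing it by its
   norm gives a state.
   The functional rho comes from a Hahn-Banach theorem of Mazur-Orlicz type, for
   which again monotonicity of the norm and positivity of c^* c are what is
   needed. Both hold in the unitization, where "h is positive" is read as
   |t - h| <= t for some t >= 0: square roots of such h come from the iteration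
   y' = (x + y^2) / 2, which converges to 1 - sqrt (1 - x). *)

(** * Hahn-Banach *)

Section MazurOrlicz.
Variables (R : realType) (V : lmodType R[i]).
Implicit Types (p q : V -> R) (K : set (V * R)).

(** The scalars are complex, but only positive real ones enter here: the functional extracted from
    [p] is real-linear and is complexified later. *)
Definition sublinear p : Prop :=
  (forall x y, p (x + y) <= p x + p y) /\
  (forall (t : R) x, 0 < t -> p (t%:C *: x) = t * p x).

(** A pair [(y, r)] of the cone stands for the constraint [- r <= f y] on the functional [f] to be
    found. *)
Definition convex_cone K : Prop :=
  [/\ K (0, 0), forall z w, K z -> K w -> K (z.1 + w.1, z.2 + w.2)
    & forall (t : R) z, 0 < t -> K z -> K (t%:C *: z.1, t * z.2)].

Lemma sublinear0 p : sublinear p -> p 0 = 0.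
Proof. by move=> [_ pZ]; have := pZ 2 0 (ltr0Sn _ 1); rewrite scaler0; lra. Qed.

Lemma sublinear_ge p x : sublinear p -> - p (- x) <= p x.
Proof.
move=> ps; have := ps.1 x (- x); rewrite subrr (sublinear0 ps); lra.
Qed.

(** Under the hypotheses of the next section this is the largest sublinear function below [p] whose
    value at [- z.1] is at most [z.2] for every [z] in [K]. *)
Definition cone_inf p K (x : V) : R := inf [set p (x + z.1) + z.2 | z in K].

Section ConeInf.
Variables (p : V -> R) (K : set (V * R)).
Hypotheses (ps : sublinear p) (Kc : convex_cone K).
Hypothesis pK : forall z, K z -> 0 <= p z.1 + z.2.

(** Keeps the infimum finite: subadditivity at [x + z.1] and [- x], combined with [pK]. *)
Lemma cone_inf_lbound x z : K z -> - p (- x) <= p (x + z.1) + z.2.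
Proof.
move=> Kz; have := ps.1 (x + z.1) (- x); have := pK Kz.
rewrite addrAC subrr add0r; lra.
Qed.

Lemma cone_inf_le x z : K z -> cone_inf p K x <= p (x + z.1) + z.2.
Proof.
move=> Kz; apply: ge_inf; last by exists z.
by exists (- p (- x)) => _ [w Kw <-]; exact: cone_inf_lbound.
Qed.

Lemma le_cone_inf x r :
  (forall z, K z -> r <= p (x + z.1) + z.2) -> r <= cone_inf p K x.
Proof.
move=> h; apply: lb_le_inf; last by move=> _ [z Kz <-]; exact: h.
by exists (p (x + 0) + 0); exists (0, 0) => //; case: Kc.
Qed.

Lemma cone_inf_le_sublinear x : cone_inf p K x <= p x.
Proof.
have [K0 _ _] := Kc.
by have := cone_inf_le x K0; rewrite /= !addr0.
Qed.

Lemma cone_infN z : K z -> cone_inf p K (- z.1) <= z.2.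
Proof.
by move=> Kz; have := cone_inf_le (- z.1) Kz; rewrite addNr sublinear0 ?add0r.
Qed.

Lemma cone_inf_sublinear : sublinear (cone_inf p K).
Proof.
have [K0 KD KZ] := Kc; split=> [x y|].
  rewrite -lerBlDl; apply: le_cone_inf => w Kw.
  rewrite lerBlDl -lerBlDr; apply: le_cone_inf => z Kz.
  rewrite lerBlDr; apply: le_trans (cone_inf_le _ (KD _ _ Kz Kw)) _ => /=.
  rewrite addrACA; have := ps.1 (x + z.1) (y + w.1); lra.
have leZ (t : R) x : 0 < t -> cone_inf p K (t%:C *: x) <= t * cone_inf p K x.
  move=> t0; rewrite -ler_pdivrMl//; apply: le_cone_inf => z Kz.
  rewrite ler_pdivrMl// mulrDr -ps.2// scalerDr.
  exact: cone_inf_le (KZ _ _ t0 Kz).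
(* The reverse inequality is [leZ] with the factor [t^-1] at the point [t x]. *)
move=> t x t0; apply/eqP; rewrite eq_le leZ//=.
rewrite -ler_pdivlMl//.
have ti0 : 0 < t^-1 by rewrite invr_gt0.
have := leZ _ (t%:C *: x) ti0.
by rewrite scalerA -rmorphM mulVf ?gt_eqF// scale1r.
Qed.

End ConeInf.

Lemma ray_cone y r : convex_cone
  [set z | exists2 t : R, 0 <= t & z = (t%:C *: y, t * r)].
Proof.
split.
- by exists 0; rewrite // scale0r mul0r.
- move=> _ _ [t t0 ->] [s s0 ->]; exists (t + s); first exact: addr_ge0.
  by rewrite /= rmorphD scalerDl mulrDl.
- move=> t _ t0 [s s0 ->]; exists (t * s); first by rewrite mulr_ge0// ltW.
  by rewrite /= scalerA rmorphM mulrA.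
Qed.

(* Replacing p by its infimum along the ray through y, tilted by - p y, gives a
   smaller sublinear function; hence a minimal one is additive. *)
Lemma minimal_sublinear_additive p : sublinear p ->
  (forall q, sublinear q -> (forall x, q x <= p x) -> q = p) ->
  forall x y, p (x + y) = p x + p y.
Proof.
move=> ps pmin x y; apply/eqP; rewrite eq_le ps.1 /=.
pose K := [set z : V * R | exists2 t : R, 0 <= t & z = (t%:C *: y, t * - p y)].
have Kc : convex_cone K := ray_cone y (- p y).
have pK z : K z -> 0 <= p z.1 + z.2.
  move=> [t t0 ->] /=; move: t0; rewrite le_eqVlt => /predU1P[<-|t0].
    by rewrite scale0r sublinear0// mul0r addr0.
  by rewrite ps.2// mulrN subrr.
have eqp : cone_inf p K = p.
  apply: pmin; first exact: cone_inf_sublinear.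
  by move=> z; exact: cone_inf_le_sublinear.
have Ky : K (y, - p y) by exists 1 => //; rewrite scale1r mul1r.
by have := cone_inf_le ps pK x Ky; rewrite eqp /=; lra.
Qed.

Lemma chain_inf_sublinear p (C : set (V -> R)) : C !=set0 ->
  (forall q, C q -> sublinear q /\ forall x, q x <= p x) ->
  (forall q q', C q -> C q' -> (forall x, q x <= q' x) \/ forall x, q' x <= q x) ->
  exists q, sublinear q /\ forall q', C q' -> forall x, q x <= q' x.
Proof.
move=> [q0 Cq0] CP Ctot; pose m x := inf [set q x | q in C].
have mle q x : C q -> m x <= q x.
  move=> Cq; apply: ge_inf; last by exists q.
  exists (- p (- x)) => _ [q' /CP[q's q'p] <-].
  by have := sublinear_ge x q's; have := q'p (- x); lra.
have lem r x : (forall q, C q -> r <= q x) -> r <= m x.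
  move=> h; apply: lb_le_inf; first by exists (q0 x); exists q0.
  by move=> _ [q Cq <-]; exact: h.
exists m; split; last by move=> q Cq x; exact: mle.
split=> [x y|t x t0].
  rewrite -lerBlDl; apply: (lem) => q Cq; rewrite lerBlDl -lerBlDr.
  apply: (lem) => q' Cq'; rewrite lerBlDr.
  (* Subadditivity of the infimum needs one member of the chain for both summands: the smaller of
     [q] and [q']. *)
  have [le_qq'|le_q'q] := Ctot _ _ Cq Cq'.
    apply: le_trans (mle _ _ Cq) _; apply: le_trans ((CP _ Cq).1.1 _ _) _.
    by rewrite lerD2r.
  apply: le_trans (mle _ _ Cq') _; apply: le_trans ((CP _ Cq').1.1 _ _) _.
  by rewrite lerD2l.
apply/eqP; rewrite eq_le; apply/andP; split.
  rewrite -ler_pdivrMl//; apply: (lem) => q Cq.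
  by rewrite ler_pdivrMl// -(CP _ Cq).1.2//; exact: mle.
apply: (lem) => q Cq; rewrite (CP _ Cq).1.2// ler_pM2l//; exact: mle.
Qed.

Lemma minimal_sublinear_exists p : sublinear p ->
  exists q, [/\ sublinear q, forall x, q x <= p x
    & forall q', sublinear q' -> (forall x, q' x <= q x) -> q' = q].
Proof.
move=> ps.
pose T := {q : V -> R | sublinear q /\ forall x, q x <= p x}.
(* The order is reversed, so that a maximal element for Zorn's lemma is a minimal sublinear
   function. *)
pose leT (q q' : T) := `[< forall x, sval q' x <= sval q x >].
have eqT (q q' : T) : sval q = sval q' -> q = q'.
  case: q q' => [q hq] [q' hq'] /= e; case: _ / e hq' => hq'.
  by rewrite (Prop_irrelevance hq hq').
have [|||C Ctot|[q [qs qp]] qmin] := @Zorn T leT.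
- by move=> q; apply/asboolP.
- move=> q r s /asboolP rq /asboolP sr; apply/asboolP => x.
  exact: le_trans (sr x) (rq x).
- move=> q r /asboolP rq /asboolP qr; apply/eqT/funext => x.
  by apply/eqP; rewrite eq_le qr rq.
- have [[q0 Cq0]|C0] := pselect (C !=set0); last first.
    (* The empty chain is bounded by [p] itself. *)
    exists (exist _ p (conj ps (fun=> lexx _))) => q Cq.
    by exfalso; apply: C0; exists q.
  have [| | |m [ms mle]] := @chain_inf_sublinear p (sval @` C).
  + by exists (sval q0); exists q0.
  + by move=> _ [q _ <-]; exact: svalP q.
  + move=> _ _ [q Cq <-] [r Cr <-].
    by have [/asboolP|/asboolP] := Ctot _ _ Cq Cr; [right|left].
  have mp x : m x <= p x.
    by apply: le_trans ((svalP q0).2 x); apply: mle; exists q0.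
  exists (exist _ m (conj ms mp)) => q Cq; apply/asboolP => x /=.
  by apply: mle; exists q.
exists q; split=> // q' q's q'q.
have q'p x : q' x <= p x by exact: le_trans (q'q x) (qp x).
by have /(congr1 sval) := qmin (exist _ q' (conj q's q'p)) (asboolT q'q).
Qed.

(** Take a minimal sublinear function below [cone_inf p K]. Minimality makes it additive, and its
    upper bound [z.2] at [- z.1] becomes the lower bound [- z.2] at [z.1]. *)
Theorem mazur_orlicz p K : sublinear p -> convex_cone K ->
  (forall z, K z -> 0 <= p z.1 + z.2) ->
  exists f : V -> R, [/\ forall x y, f (x + y) = f x + f y,
    forall (t : R) x, 0 < t -> f (t%:C *: x) = t * f x,
    forall x, f x <= p x & forall z, K z -> - z.2 <= f z.1].
Proof.
move=> ps Kc pK.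
have [f [fs fle fmin]] := minimal_sublinear_exists (cone_inf_sublinear ps Kc pK).
exists f; split; first exact: minimal_sublinear_additive.
- exact: fs.2.
- by move=> x; apply: le_trans (fle x) _; exact: cone_inf_le_sublinear.
- move=> z Kz; have := sublinear_ge z.1 fs.
  have := fle (- z.1); have := cone_infN ps pK Kz; lra.
Qed.

End MazurOrlicz.

(** * Identities in abelian groups by reflection *)

Inductive zterm :=
  ZVar of nat | ZZero | ZAdd of zterm & zterm | ZOpp of zterm
| ZMuln of zterm & nat.

Fixpoint zeval (V : zmodType) (env : seq V) t : V :=
  match t with
  | ZVar j => env`_j
  | ZZero => 0
  | ZAdd u v => zeval env u + zeval env v
  | ZOpp u => - zeval env u
  | ZMuln u n => zeval env u *+ n
  end.

Fixpoint zcoef t (i : nat) : int :=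
  match t with
  | ZVar j => (i == j)%:Z
  | ZZero => 0
  | ZAdd u v => zcoef u i + zcoef v i
  | ZOpp u => - zcoef u i
  | ZMuln u n => zcoef u i * n%:Z
  end.

Lemma zevalE (V : zmodType) (env : seq V) t :
  zeval env t = \sum_(i < size env) env`_i *~ zcoef t i.
Proof.
elim: t => [j||u IHu v IHv|u IHu|u IHu n] /=.
- have [js|sj] := ltnP j (size env).
    rewrite (bigD1 (Ordinal js)) //= eqxx mulr1z big1 ?addr0// => i.
    by rewrite -val_eqE /= => /negPf->; rewrite mulr0z.
  rewrite nth_default// big1// => i _.
  by rewrite ltn_eqF ?mulr0z// (leq_trans (ltn_ord i)).
- by rewrite big1.
- by rewrite IHu IHv -big_split; apply: eq_bigr => i _; rewrite mulrzDr.
- by rewrite IHu -sumrN; apply: eq_bigr => i _; rewrite mulrNz.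
- by rewrite IHu -sumrMnl; apply: eq_bigr => i _; rewrite mulrzA -pmulrn.
Qed.

(** The hypothesis compares integer coefficients atom by atom and is settled by computation, which
    lets [zmod] discharge it with [isT]. *)
Lemma zeval_eq (V : zmodType) (env : seq V) t u :
  all (fun i => zcoef t i == zcoef u i) (iota 0 (size env)) ->
  zeval env t = zeval env u.
Proof.
move=> /allP h; rewrite !zevalE; apply: eq_bigr => i _.
by rewrite (eqP (h i _)) // mem_iota add0n ltn_ord.
Qed.

(* Atoms are compared up to unification, since the same product may be found
   under different canonical structures. *)
Ltac zsame t u := match goal with _ => unify t u end.

Ltac zatoms t l :=
  lazymatch t with
  | @Algebra.add _ ?a ?b => let l := zatoms a l in zatoms b l
  | @Algebra.opp _ ?a => zatoms a l
  | @Algebra.zero _ => l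
  | @Algebra.natmul _ ?a _ => zatoms a l
  | _ => let rec mem l' :=
           lazymatch l' with
           | nil => constr:(t :: l)
           | ?u :: ?l'' => match goal with
                           | _ => let _ := zsame t u in l
                           | _ => mem l''
                           end
           end in mem l
  end.

Ltac zquote l t :=
  lazymatch t with
  | @Algebra.add _ ?a ?b =>
      let a := zquote l a in let b := zquote l b in constr:(ZAdd a b)
  | @Algebra.opp _ ?a => let a := zquote l a in constr:(ZOpp a)
  | @Algebra.zero _ => constr:(ZZero)
  | @Algebra.natmul _ ?a ?n => let a := zquote l a in constr:(ZMuln a n)
  | _ => let rec idx l' :=
           lazymatch l' with
           | ?u :: ?l'' => match goal with
                           | _ => let _ := zsame t u in constr:(O)
                           | _ => let n := idx l'' in constr:(S n)
                           end
           end in let n := idx l in constr:(ZVar n)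
  end.

Ltac zmod :=
  lazymatch goal with
  | |- @eq ?V ?a ?b =>
      let l := zatoms a (@nil V) in let l := zatoms b l in
      let t := zquote l a in let u := zquote l b in
      exact: (@zeval_eq _ l t u isT)
  end.

(** * Positivity in unital C*-algebras *)

Section Modulus.
Variable R : realType.

Lemma norm_nrm (V : normedZmodType R[i]) (x : V) : `|x| = (nrm x)%:C.
Proof.
have := normr_ge0 x; rewrite /nrm; case: (`|x|) => a b; rewrite lecE /=.
by move=> /andP[/eqP-> _].
Qed.

Lemma nrm_real (t : R) : nrm (t%:C : R[i]) = `|t|.
Proof. by rewrite /nrm normc_def /= expr0n addr0 sqrtr_sqr. Qed.

Lemma conj_real (t : R) : Num.conj (t%:C) = t%:C :> R[i].
Proof. by apply: conj_Creal; rewrite realE !lecR -realE num_real. Qed.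

Lemma nrmi : nrm ('i : R[i]) = 1.
Proof. by rewrite /nrm normCi. Qed.

End Modulus.

(** Stated with sequences and a bare function [N], so that it applies to the operator norm on the
    unitization, which is not a library norm. *)
Definition scomplete (R : realType) (V : zmodType) (N : V -> R) : Prop :=
  forall u : nat -> V,
    (forall e, 0 < e -> exists n, forall m, (n <= m)%N -> N (u m - u n) <= e) ->
    exists l, forall e, 0 < e ->
      exists n, forall m, (n <= m)%N -> N (u m - l) <= e.

(** Abstract unital $C^*$-algebra over which positivity is developed; the unitization is the
    instance used. *)
Record unital_cstar_norm (R : realType) (B : algType R[i]) (st : B -> B)
    (N : B -> R) : Prop := UnitalCStarNorm {
  unormD : forall x y, N (x + y) <= N x + N y;
  unormZ : forall (c : R[i]) x, N (c *: x) = nrm c * N x;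
  unormM : forall x y, N (x * y) <= N x * N y;
  unorm_eq0 : forall x, N x = 0 -> x = 0;
  unorm_star : forall x, N (st x * x) = N x ^+ 2;
  ustarD : forall x y, st (x + y) = st x + st y;
  ustarZ : forall (c : R[i]) x, st (c *: x) = Num.conj c *: st x;
  ustarM : forall x y, st (x * y) = st y * st x;
  ustarK : forall x, st (st x) = x;
  unorm_complete : scomplete N
}.

Section UnitalCStar.
Variables (R : realType) (B : algType R[i]) (st : B -> B) (N : B -> R).
Hypothesis BN : unital_cstar_norm st N.
Implicit Types (x y z h s w : B) (t r : R).

Let ND := unormD BN.
Let NZ := unormZ BN.
Let NM := unormM BN.
Let Nst := unorm_star BN.

Lemma unormZr t x : 0 <= t -> N (t%:C *: x) = t * N x.
Proof. by move=> t0; rewrite NZ nrm_real ger0_norm. Qed.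

Lemma unorm0 : N 0 = 0.
Proof. by rewrite -(scale0r (0 : B)) (unormZr _ (lexx _)) mul0r. Qed.

Lemma unormN x : N (- x) = N x.
Proof. by rewrite -scaleN1r NZ /nrm normrN1 /= mul1r. Qed.

Lemma unorm_ge0 x : 0 <= N x.
Proof. by have := ND x (- x); rewrite subrr unorm0 unormN; lra. Qed.

Lemma unormB x y : N (x - y) <= N x + N y.
Proof. by rewrite -(unormN y). Qed.

(** Cancel one factor [N x] in [N x ^+ 2 = N (st x * x) <= N (st x) * N x]. *)
Lemma unorm_le_star x : N x <= N (st x).
Proof.
have := NM (st x) x; rewrite Nst expr2.
have := unorm_ge0 x; rewrite le_eqVlt => /predU1P[<- _|x0].
  exact: unorm_ge0.
by rewrite ler_pM2r.
Qed.

Lemma unormst x : N (st x) = N x.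
Proof.
apply/eqP; rewrite eq_le unorm_le_star andbT.
by have := unorm_le_star (st x); rewrite (ustarK BN).
Qed.

Lemma unorm_sq s : st s = s -> N (s * s) = N s ^+ 2.
Proof. by move=> {1}<-. Qed.

Lemma ustarN x : st (- x) = - st x.
Proof. by rewrite -scaleN1r (ustarZ BN) rmorphN rmorph1 scaleN1r. Qed.

Lemma ustarZr t x : st (t%:C *: x) = t%:C *: st x.
Proof. by rewrite (ustarZ BN) conj_real. Qed.

Lemma ustarB x y : st (x - y) = st x - st y.
Proof. by rewrite (ustarD BN) ustarN. Qed.

Lemma ustar0 : st 0 = 0.
Proof. by rewrite -(scale0r (0 : B)) (ustarZ BN) rmorph0 !scale0r. Qed.

Lemma ustar1 : st 1 = 1.
Proof.
by rewrite -(mulr1 (st 1)) -{2}(ustarK BN 1) -(ustarM BN) mulr1 (ustarK BN).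
Qed.

Lemma unorm1 : N 1 <= 1.
Proof.
have := Nst 1; rewrite ustar1 mulr1; have := unorm_ge0 1; nra.
Qed.

Lemma unorm_small C x : (forall e, 0 < e -> N x <= C * e) -> x = 0.
Proof.
move=> h; apply: (unorm_eq0 BN); apply/eqP; rewrite eq_le unorm_ge0 andbT.
have [C0|C0] := leP C 0; first by have := h 1 ltr01; lra.
apply/ler_addgt0Pr => e e0; rewrite add0r.
have := h (e / C) (divr_gt0 e0 C0).
by rewrite mulrC divfK ?gt_eqF.
Qed.

Local Notation "t %:S" := (t%:C *: (1 : B)) (at level 1, format "t %:S").

Lemma scalMl t x : t%:S * x = t%:C *: x.
Proof. by rewrite -scalerAl mul1r. Qed.

Lemma scalMr t x : x * t%:S = t%:C *: x.
Proof. by rewrite -scalerAr mulr1. Qed.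

Lemma scaler_realA t r x : t%:C *: (r%:C *: x) = (t * r)%:C *: x.
Proof. by rewrite scalerA -rmorphM. Qed.

(** * Square roots by a convergent iteration *)

Section SquareRoot.
Variable x : B.
Hypothesis x1 : N x <= 1.

Fixpoint sqrt_seq n : B :=
  if n is n'.+1 then (2^-1)%:C *: (x + sqrt_seq n' * sqrt_seq n') else 0.

(* The same iteration for x = 1 in the reals, which dominates [sqrt_seq]. *)
Fixpoint sqrt_maj n : R :=
  if n is n'.+1 then 2^-1 * (1 + sqrt_maj n' ^+ 2) else 0.

Lemma sqrt_seqS n :
  sqrt_seq n.+1 = (2^-1)%:C *: (x + sqrt_seq n * sqrt_seq n).
Proof. by []. Qed.

Lemma sqrt_majS n : sqrt_maj n.+1 = 2^-1 * (1 + sqrt_maj n ^+ 2).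
Proof. by []. Qed.

Lemma sqrt_maj_bounds n : 0 <= sqrt_maj n <= 1.
Proof.
elim: n => [|n /andP[h0 h1]] /=; first by rewrite lexx ler01.
by apply/andP; split; nra.
Qed.

Lemma sqrt_seq_comm z n : z * x = x * z -> z * sqrt_seq n = sqrt_seq n * z.
Proof.
move=> zx; elim: n => [|n IH] /=; first by rewrite mulr0 mul0r.
by rewrite -scalerAr -scalerAl mulrDr mulrDl zx mulrA IH -mulrA IH mulrA.
Qed.

Lemma sqrt_seq_star n : st x = x -> st (sqrt_seq n) = sqrt_seq n.
Proof.
move=> sx; elim: n => [|n IH] /=; first exact: ustar0.
by rewrite ustarZr (ustarD BN) (ustarM BN) IH sx.
Qed.

Lemma unorm_sqrt_seq n : N (sqrt_seq n) <= sqrt_maj n.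
Proof.
elim: n => [|n IH] /=; first by rewrite unorm0.
have i0 : 0 <= 2^-1 :> R by rewrite invr_ge0.
rewrite (unormZr _ i0) ler_pM2l ?invr_gt0//.
apply: le_trans (ND _ _) _; apply: lerD => //.
apply: le_trans (NM _ _) _; rewrite expr2.
by apply: ler_pM => //; exact: unorm_ge0.
Qed.

(** Successive terms are polynomials in [x], hence commute, so an increment is half the product of
    the previous increment and the sum of the two terms. The majorant obeys the same identity, and
    induction compares the two. *)
Lemma unorm_sqrt_seqS n :
  N (sqrt_seq n.+1 - sqrt_seq n) <= sqrt_maj n.+1 - sqrt_maj n.
Proof.
elim: n => [|n IH]; first by rewrite !subr0; exact: unorm_sqrt_seq.
set y := sqrt_seq n in IH *; set y' := sqrt_seq n.+1 in IH *.
set a := sqrt_maj n in IH *; set a' := sqrt_maj n.+1 in IH *.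
have -> : sqrt_seq n.+2 - y' = (2^-1)%:C *: ((y' - y) * (y' + y)).
  have yy' : y' * y = y * y'.
    by apply: sqrt_seq_comm; apply/esym/sqrt_seq_comm.
  rewrite (sqrt_seqS n.+1) -/y' {3}/y' sqrt_seqS -/y -scalerBr.
  congr (_ *: _); rewrite mulrDr !mulrBl yy'; zmod.
have -> : sqrt_maj n.+2 - a' = 2^-1 * ((a' - a) * (a' + a)).
  by rewrite (sqrt_majS n.+1) -/a' {2}/a' sqrt_majS -/a; field.
have i0 : 0 <= 2^-1 :> R by rewrite invr_ge0.
rewrite (unormZr _ i0) ler_pM2l ?invr_gt0//.
apply: le_trans (NM _ _) _; apply: ler_pM => //; try exact: unorm_ge0.
by apply: le_trans (ND _ _) _; apply: lerD; exact: unorm_sqrt_seq.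
Qed.

Lemma unorm_sqrt_seqD n k :
  N (sqrt_seq (n + k) - sqrt_seq n) <= sqrt_maj (n + k) - sqrt_maj n.
Proof.
elim: k => [|k IH]; first by rewrite addn0 !subrr unorm0.
rewrite addnS -(subrKA (sqrt_seq (n + k))).
apply: le_trans (ND _ _) _; have := unorm_sqrt_seqS (n + k); lra.
Qed.

(** The majorant is bounded by [1]. From an index where it is within [e] of its supremum, it rises
    by at most [e], and this dominates the increments of [sqrt_seq]. *)
Lemma sqrt_seq_cvg : exists y, forall e, 0 < e ->
  exists n, forall m, (n <= m)%N -> N (sqrt_seq m - y) <= e.
Proof.
apply: (unorm_complete BN) => e e0.
pose E := range sqrt_maj.
have Es : has_sup E.
  split; first by exists (sqrt_maj 0); exists 0%N.
  by exists 1 => _ [n _ <-]; have /andP[] := sqrt_maj_bounds n.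
have [_ [n _ <-] ne] := sup_adherent e0 Es.
exists n => m nm; rewrite -(subnKC nm).
apply: le_trans (unorm_sqrt_seqD _ _) _.
have : sqrt_maj (n + (m - n)) <= sup E.
  by apply: sup_upper_bound => //; exists (n + (m - n))%N.
lra.
Qed.

(** The limit [y] satisfies [y = (x + y * y) / 2], which rearranges to the equation for [1 - y]. The
    other properties pass to the limit from the terms of the sequence. *)
Lemma one_sub_sqrt : exists y,
  [/\ N y <= 1, (1 - y) * (1 - y) = 1 - x,
      forall z, z * x = x * z -> z * y = y * z & st x = x -> st y = y].
Proof.
have [y yP] := sqrt_seq_cvg; exists y.
have Nu n : N (sqrt_seq n) <= 1.
  by apply: le_trans (unorm_sqrt_seq n) _; have /andP[] := sqrt_maj_bounds n.
have y1 : N y <= 1.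
  apply/ler_addgt0Pr => e /yP[n /(_ n (leqnn n)) ne].
  rewrite -(subKr (sqrt_seq n) y); apply: le_trans (unormB _ _) _.
  exact: lerD (Nu n) ne.
have yE : y = (2^-1)%:C *: (x + y * y).
  apply/eqP; rewrite -subr_eq0; apply/eqP/(@unorm_small 2) => e /yP[n ne].
  set u := sqrt_seq n.
  have := ne n.+1 (leqnSn n); rewrite /= -/u => ne1.
  have {ne} ne : N (u - y) <= e by exact: ne.
  (* The first bracket equals [u * u - y * y]; the second difference is the next term minus [y].
     With [u] and [y] of norm at most [1] the total is at most [2 * e]. *)
  have -> : y - (2^-1)%:C *: (x + y * y) = (2^-1)%:C *: (u * (u - y) + (u - y) * y)
     - ((2^-1)%:C *: (x + u * u) - y).
    rewrite mulrBr mulrBl subrKA !scalerBr !scalerDr; zmod.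
  apply: le_trans (unormB _ _) _.
  have i0 : 0 <= 2^-1 :> R by rewrite invr_ge0.
  rewrite (unormZr _ i0).
  have := ND (u * (u - y)) ((u - y) * y).
  have := NM u (u - y); have := NM (u - y) y; have := Nu n; rewrite -/u.
  have := unorm_ge0 (u - y); have := unorm_ge0 u; have := unorm_ge0 y; nra.
split=> //.
- rewrite mulrBr mulr1 mulrBl mul1r.
  have xE : x = y + y - y * y.
    have {1}-> : y + y = x + y * y; last by rewrite addrK.
    rewrite -mulr2n -scaler_nat {1}yE scalerA.
    have -> : 2%:R * (2^-1)%:C = 1 :> R[i].
      by rewrite -(rmorph_nat (real_complex R)) -rmorphM mulfV ?rmorph1// pnatr_eq0.
    by rewrite scale1r.
  rewrite xE; zmod.
- move=> z zx; apply/eqP; rewrite -subr_eq0; apply/eqP.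
  apply: (@unorm_small (2 * N z)) => e /yP[n /(_ n (leqnn n)) ne].
  have -> : z * y - y * z = (sqrt_seq n - y) * z - z * (sqrt_seq n - y).
    rewrite mulrBl mulrBr (sqrt_seq_comm n zx); zmod.
  apply: le_trans (unormB _ _) _.
  have := NM z (sqrt_seq n - y); have := NM (sqrt_seq n - y) z.
  have := unorm_ge0 z; nra.
- move=> sx; apply/eqP; rewrite -subr_eq0; apply/eqP.
  apply: (@unorm_small 2) => e /yP[n /(_ n (leqnn n)) ne].
  have -> : st y - y = (sqrt_seq n - y) - st (sqrt_seq n - y).
    rewrite ustarB sqrt_seq_star//; zmod.
  apply: le_trans (unormB _ _) _; rewrite unormst; lra.
Qed.

End SquareRoot.

Lemma ustar_scal t : st t%:S = t%:S.
Proof. by rewrite ustarZr ustar1. Qed.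

Lemma scal_comm t z : z * t%:S = t%:S * z.
Proof. by rewrite scalMl scalMr. Qed.

Lemma unorm_scal t : 0 <= t -> N t%:S <= t.
Proof. by move=> t0; rewrite unormZr// ler_piMr// unorm1. Qed.

(* [w + i s] is normal with squared modulus [r]. *)
Lemma unorm_sum_sq s w r : st s = s -> st w = w -> s * w = w * s -> 0 <= r ->
  s * s + w * w = r%:S -> N s ^+ 2 <= r.
Proof.
move=> ss sw swC r0 swr; pose u := w + 'i *: s.
have stu : st u = w - 'i *: s.
  by rewrite (ustarD BN) (ustarZ BN) sw ss conjCi scaleNr.
have uu : st u * u = r%:S.
  rewrite stu mulrDr !mulrBl -!scalerAl -!scalerAr swC scalerA -(expr2 'i) sqrCi.
  rewrite -swr scaleN1r; zmod.
have Nu : N u ^+ 2 <= r by rewrite -Nst uu unorm_scal.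
have Nsu : 2 * N s <= 2 * N u.
  have -> : 2 * N s = N (u - st u).
    have -> : u - st u = 2%:C *: ('i *: s).
      by rewrite stu /u rmorph_nat scaler_nat; zmod.
    by rewrite (unormZr _ (ler0n _ 2)) NZ nrmi mul1r.
  by apply: le_trans (unormB _ _) _; rewrite unormst; lra.
by have := unorm_ge0 s; nra.
Qed.

(** For self-adjoint [h] the norm condition says that the spectrum lies in [[0, 2t]]; in this form,
    stability under sums is the triangle inequality. *)
Definition upos h : Prop := st h = h /\ exists2 t, 0 <= t & N (t%:S - h) <= t.

Lemma upos0 : upos 0.
Proof. by split; [exact: ustar0|exists 0; rewrite // scale0r subr0 unorm0]. Qed.

Lemma uposD h k : upos h -> upos k -> upos (h + k).
Proof.
move=> [sh [t t0 th]] [sk [r r0 rk]]; split; first by rewrite (ustarD BN) sh sk.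
exists (t + r); first exact: addr_ge0.
have -> : (t + r)%:S - (h + k) = (t%:S - h) + (r%:S - k).
  by rewrite rmorphD scalerDl; zmod.
by apply: le_trans (ND _ _) _; exact: lerD.
Qed.

Lemma uposZ t h : 0 <= t -> upos h -> upos (t%:C *: h).
Proof.
move=> t0 [sh [r r0 rh]]; split; first by rewrite ustarZr sh.
exists (t * r); first exact: mulr_ge0.
by rewrite -scaler_realA -scalerBr unormZr// ler_wpM2l.
Qed.

(** For [t > 0] the element [x = 1 - h / t] has norm at most [1], so [one_sub_sqrt] gives a root of
    [h / t], which is rescaled by the root of [t]. For [t = 0] the condition forces [h = 0]. *)
Lemma upos_sqrt h : upos h -> exists s,
  [/\ st s = s, s * s = h, upos s & forall z, z * h = h * z -> z * s = s * z].
Proof.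
move=> [sh [t]]; rewrite le_eqVlt => /predU1P[<-|t0] th.
  exists 0; split; rewrite ?mulr0 ?ustar0//; last 2 first.
  - exact: upos0.
  - by move=> z _; rewrite mulr0 mul0r.
  apply/esym/(unorm_eq0 BN)/eqP; rewrite eq_le unorm_ge0 andbT.
  by rewrite -(unormN h) -sub0r -(scale0r (1 : B)).
have ti0 : 0 <= t^-1 by rewrite invr_ge0 ltW.
pose x := t^-1%:C *: (t%:S - h).
have xE : x = 1 - t^-1%:C *: h.
  by rewrite /x scalerBr scaler_realA mulVf ?gt_eqF// scale1r.
have x1 : N x <= 1 by rewrite /x unormZr// ler_pdivrMl// mulr1.
have [y [y1 yE yC yS]] := one_sub_sqrt x1.
have sx : st x = x by rewrite /x ustarZr ustarB ustar_scal sh.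
have st0 := sqrtr_ge0 t.
exists ((Num.sqrt t)%:C *: (1 - y)); split.
- by rewrite ustarZr ustarB ustar1 yS.
- rewrite -scalerAl -scalerAr scaler_realA yE -(expr2 (Num.sqrt _)) sqr_sqrtr ?ltW//.
  by rewrite xE subKr scaler_realA mulfV ?gt_eqF// scale1r.
- split; first by rewrite ustarZr ustarB ustar1 yS.
  exists (Num.sqrt t) => //.
  by rewrite -scalerBr subKr unormZr// ler_piMr.
- move=> z zh; rewrite -scalerAl -scalerAr mulrBr mulrBl mulr1 mul1r yC//.
  by rewrite xE mulrBr mulrBl mulr1 mul1r -scalerAl -scalerAr zh.
Qed.

(** A self-adjoint root [w] of [t - s * s] commuting with [s] exists by [one_sub_sqrt]; then
    [unorm_sum_sq] bounds [N w ^+ 2], which is the left-hand side. *)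
Lemma unorm_sub_sq s t : st s = s -> N s ^+ 2 <= t -> N (t%:S - s * s) <= t.
Proof.
move=> ss Ns; have : 0 <= t by apply: le_trans Ns; exact: sqr_ge0.
rewrite le_eqVlt => /predU1P[t0|t0].
  have -> : s = 0.
    by apply: (unorm_eq0 BN); move: Ns; rewrite -t0; have := unorm_ge0 s; nra.
  by rewrite mulr0 subr0 -t0 unorm_scal.
have ti0 : 0 <= t^-1 by rewrite invr_ge0 ltW.
pose x := t^-1%:C *: (s * s).
have x1 : N x <= 1 by rewrite /x unormZr// unorm_sq// ler_pdivrMl// mulr1.
have [y [y1 yE yC yS]] := one_sub_sqrt x1.
have sx : st x = x by rewrite /x ustarZr (ustarM BN) ss.
have sxC : s * x = x * s by rewrite /x -scalerAl -scalerAr mulrA.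
pose w := (Num.sqrt t)%:C *: (1 - y).
have sw : st w = w by rewrite /w ustarZr ustarB ustar1 yS.
have ww : w * w = t%:S - s * s.
  rewrite -scalerAl -scalerAr scaler_realA yE -(expr2 (Num.sqrt _)) sqr_sqrtr ?ltW//.
  by rewrite scalerBr scaler_realA mulfV ?gt_eqF// scale1r.
rewrite -ww unorm_sq//; apply: (@unorm_sum_sq w s) => //; last 2 first.
- exact: ltW.
- by rewrite ww subrK.
by rewrite /w -scalerAl -scalerAr mulrBr mulrBl mulr1 mul1r yC.
Qed.

Lemma upos_sq s : st s = s -> upos (s * s).
Proof.
move=> ss; split; first by rewrite (ustarM BN) ss.
by exists (N s ^+ 2); [exact: sqr_ge0|exact: unorm_sub_sq].
Qed.

(** Any bound on [N h] can serve as the witness in [upos]. *)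
Lemma unorm_sub_upos h t : upos h -> N h <= t -> N (t%:S - h) <= t.
Proof.
move=> /upos_sqrt[s [ss <- _ _]]; rewrite unorm_sq//; exact: unorm_sub_sq.
Qed.

Lemma upos_le h r : 0 <= r -> upos h -> upos (r%:S - h) -> N h <= r.
Proof.
move=> r0 /upos_sqrt[w [sw wh _ wC]] /upos_sqrt[s [ss srh _ sC]].
rewrite -wh unorm_sq//; apply: (@unorm_sum_sq w s) => //; last first.
  by rewrite wh srh addrC subrK.
by apply: sC; rewrite mulrBr mulrBl scal_comm -wh mulrA.
Qed.

(** With [r = N (h + k)], the element [r - h] is the sum of [r - (h + k)] and [k], both positive, so
    [upos_le] applies. *)
Lemma unorm_uposD h k : upos h -> upos k -> N h <= N (h + k).
Proof.
move=> ph pk; apply: upos_le => //; first exact: unorm_ge0.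
set r := N (h + k).
have -> : r%:S - h = (r%:S - (h + k)) + k by zmod.
apply: uposD => //; have [shk _] := uposD ph pk.
split; first by rewrite ustarB ustar_scal shk.
by exists r; [exact: unorm_ge0|rewrite subKr].
Qed.

Lemma ustar_self_adjD x : st (x + st x) = x + st x.
Proof. by rewrite (ustarD BN) (ustarK BN) addrC. Qed.

(** Twice the sum is [a * a + b * b], where the self-adjoint [a] and [b] are, up to real factors,
    the real and imaginary parts of [d]. *)
Lemma upos_starD d : upos (st d * d + d * st d).
Proof.
pose a := d + st d; pose b := 'i *: (d - st d).
have sa : st a = a by exact: ustar_self_adjD.
have sb : st b = b.
  by rewrite /b (ustarZ BN) ustarB (ustarK BN) conjCi scaleNr -scalerN opprB.
have -> : st d * d + d * st d = (2^-1)%:C *: (a * a + b * b).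
  have -> : a * a + b * b = 2%:C *: (st d * d + d * st d).
    rewrite /b -scalerAl -scalerAr scalerA -(expr2 'i) sqrCi scaleN1r.
    by rewrite !mulrBl !mulrBr !mulrDl !mulrDr rmorph_nat scaler_nat; zmod.
  by rewrite scaler_realA mulVf ?scale1r.
by apply: uposZ; [rewrite invr_ge0|apply: uposD; exact: upos_sq].
Qed.

(* With P = g^2 and Q = d d^*, both positive of norm n, one has
   d (n + P) = (n - Q) d; the right side has squared norm at most n^3 and the
   left side at least 2 n^3. *)
Lemma star_neg_eq0 d g : st g = g -> st d * d = - (g * g) -> d = 0.
Proof.
move=> sg dg; set P := g * g in dg; pose Q := d * st d; pose n := N d ^+ 2.
have sP : st P = P by rewrite /P (ustarM BN) sg.
have pP : upos P := upos_sq sg.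
have pQ : upos Q.
  have -> : Q = (st d * d + d * st d) + P by rewrite dg; zmod.
  by apply: uposD => //; exact: upos_starD.
have n0 : 0 <= n := sqr_ge0 _.
have NP : N P = n by rewrite -unormN -dg Nst.
have NQ : N Q = n by rewrite /Q -{1}(ustarK BN d) Nst unormst.
have dPQ : d * (n%:S + P) = (n%:S - Q) * d.
  rewrite mulrDr mulrBl scal_comm; congr (_ + _).
  by rewrite -[P]opprK -dg mulrN mulrA.
have le1 : N (d * (n%:S + P)) ^+ 2 <= n ^+ 3.
  have le1' : N (d * (n%:S + P)) <= n * N d.
    rewrite dPQ; apply: le_trans (NM _ _) _; apply: ler_wpM2r.
      exact: unorm_ge0.
    by apply: unorm_sub_upos => //; rewrite NQ.
  have -> : n ^+ 3 = (n * N d) ^+ 2 by rewrite [RHS]exprMn -/n -exprSr.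
  by rewrite ler_sqr ?nnegrE ?unorm_ge0// mulr_ge0// unorm_ge0.
(* By the $C^*$-identity the right side is the norm of [(n + P) P (n + P)], that is
   [n^2 P + 2 n P^2 + P^3]. All summands are positive, so by monotonicity it is at least the norm of
   [2 n P^2]. *)
have le2 : 2 * n ^+ 3 <= N (d * (n%:S + P)) ^+ 2.
  have -> : 2 * n ^+ 3 = N ((2 * n)%:C *: (P * P)).
    by rewrite (unormZr _ (mulr_ge0 (ler0n _ 2) n0)) unorm_sq// NP; ring.
  set Y := _ *: _; rewrite -Nst (ustarM BN) (ustarD BN) ustar_scal sP.
  rewrite mulrA -[_ * st d * d]mulrA.
  rewrite dg mulrN mulNr unormN.
  rewrite mulrDr !scalMr !mulrDl !scalMl scalerDr -scalerAl scaler_realA.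
  set X := (X in _ <= N X).
  have -> : X = Y + ((n * n)%:C *: P + P * P * P).
    have -> : Y = n%:C *: (P * P) + n%:C *: (P * P).
      by rewrite -scalerDl -rmorphD /Y; congr (_%:C *: _); ring.
    rewrite /X; zmod.
  apply: unorm_uposD.
    by apply: uposZ (upos_sq sP); exact: mulr_ge0.
  apply: uposD; first by apply: uposZ => //; exact: mulr_ge0.
  have -> : P * P * P = (g * P) * (g * P) by rewrite /P !mulrA.
  by apply: upos_sq; rewrite (ustarM BN) sg sP /P mulrA.
apply: (unorm_eq0 BN); have {le1 le2} := le_trans le2 le1.
have [/eqP|nn] := eqVneq n 0; first by rewrite sqrf_eq0 => /eqP.
have : 0 < n ^+ 3 by rewrite exprn_gt0// lt_neqAle eq_sym nn.
lra.
Qed.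

(* With s the modulus of h = c^* c and k = s - h, twice the negative part of h,
   the element d = c k satisfies d^* d = k h k = - s k^2, so that d = 0. *)
Theorem upos_star c : upos (st c * c).
Proof.
set h := st c * c.
have sh : st h = h by rewrite /h (ustarM BN) (ustarK BN).
have [s [ss shh ps sC]] := upos_sqrt (upos_sq sh).
have hs : h * s = s * h by apply: sC; rewrite mulrA.
(* A root [q] of [s] turns [s * k * k] into the square of the self-adjoint [q * k], as
   [star_neg_eq0] requires. *)
have [q [sq qs _ qC]] := upos_sqrt ps.
pose k := s - h.
have sk : st k = k by rewrite ustarB ss sh.
have hk : h * k = k * h by rewrite mulrBr mulrBl hs.
have hk' : h * k = - (s * k) by rewrite !mulrBr hs shh; zmod.
have qk : q * k = k * q.
  apply/esym; rewrite mulrBl mulrBr; congr (_ - _); last first.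
    by apply: qC.
  by rewrite -qs mulrA.
have gg : (q * k) * (q * k) = s * k * k.
  by rewrite -mulrA [k * _]mulrA -qk !mulrA qs.
have khk : k * h * k = - (s * k * k) by rewrite -hk hk' mulNr.
have d0 : c * k = 0.
  apply: (@star_neg_eq0 _ (q * k)); first by rewrite (ustarM BN) sq sk qk.
  by rewrite gg -khk (ustarM BN) sk !mulrA -[k * st c * c]mulrA.
have khk0 : k * h * k = 0.
  by rewrite /h !mulrA -[_ * c * k]mulrA d0 mulr0.
have k3 : k * k * k = 0.
  rewrite {1}/k mulrBl mulrBl hk khk0 subr0.
  by apply/eqP; rewrite -oppr_eq0 -khk khk0.
have k0 : k = 0.
  (* For self-adjoint [k] the norm of the fourth power is the fourth power of the norm, so a
     nilpotent [k] vanishes. *)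
  have : N ((k * k) * (k * k)) = 0 by rewrite mulrA k3 mul0r unorm0.
  rewrite unorm_sq ?(ustarM BN) ?sk// unorm_sq// => /eqP.
  by rewrite !sqrf_eq0 => /eqP/(unorm_eq0 BN).
by have -> : h = s; [apply/esym/eqP; rewrite -subr_eq0; apply/eqP|].
Qed.

End UnitalCStar.

(** * The unitization of a C*-algebra *)

Section NrmTheory.
Variables (R : realType) (V : normedModType R[i]).
Implicit Types (x y : V) (t : R) (c : R[i]).

Lemma nrm_ge0 x : 0 <= nrm x.
Proof. by rewrite -lecR -norm_nrm; exact (normr_ge0 _). Qed.

Lemma nrmD x y : nrm (x + y) <= nrm x + nrm y.
Proof. by rewrite -lecR rmorphD /= -!norm_nrm; exact (ler_normD _ _). Qed.

Lemma nrmZ c x : nrm (c *: x) = nrm c * nrm x.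
Proof. by apply/complexI; rewrite rmorphM /= -!norm_nrm normrZ. Qed.

Lemma nrmZr t x : 0 <= t -> nrm (t%:C *: x) = t * nrm x.
Proof. by move=> t0; rewrite nrmZ nrm_real ger0_norm. Qed.

Lemma nrm0 : nrm (0 : V) = 0.
Proof. by rewrite /nrm normr0. Qed.

Lemma nrm_eq0 x : nrm x = 0 -> x = 0.
Proof. by move=> x0; apply/normr0_eq0; rewrite norm_nrm x0. Qed.

Lemma nrm_gt0 x : x <> 0 -> 0 < nrm x.
Proof.
move=> x0; rewrite lt_neqAle nrm_ge0 andbT eq_sym.
by apply/eqP => /nrm_eq0.
Qed.

End NrmTheory.

Section ComplexModulus.
Variable R : realType.
Implicit Types c d : R[i].

Lemma nrmcM c d : nrm (c * d) = nrm c * nrm d.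
Proof. by apply/complexI; rewrite rmorphM /= -!norm_nrm normrM. Qed.

Lemma nrmc_ge0 c : 0 <= nrm c.
Proof. by rewrite -lecR -norm_nrm; exact (normr_ge0 _). Qed.

Lemma nrmcD c d : nrm (c + d) <= nrm c + nrm d.
Proof. by rewrite -lecR rmorphD /= -!norm_nrm; exact (ler_normD _ _). Qed.

Lemma nrmc_eq0 c : nrm c = 0 -> c = 0.
Proof. by move=> x0; apply/normr0_eq0; rewrite norm_nrm x0. Qed.

Lemma nrmc_conj c : nrm (Num.conj c) = nrm c.
Proof. by rewrite /nrm norm_conjC. Qed.

End ComplexModulus.

Section CStarTheory.
Variables (R : realType) (A : cstarAlgType R).
Implicit Types (a b : A) (c : R[i]).

Lemma cmul0l a : cmul 0 a = 0.
Proof. by rewrite -(scale0r (0 : A)) cmulZl !scale0r. Qed.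

Lemma cmul0r a : cmul a 0 = 0.
Proof. by rewrite -(scale0r (0 : A)) cmulZr !scale0r. Qed.

Lemma star0 : star 0 = 0 :> A.
Proof. by rewrite -(scale0r (0 : A)) starZ rmorph0 !scale0r. Qed.

Lemma starN a : star (- a) = - star a.
Proof. by rewrite -scaleN1r starZ rmorphN rmorph1 scaleN1r. Qed.

Lemma nrm_cmul a b : nrm (cmul a b) <= nrm a * nrm b.
Proof. by rewrite -lecR rmorphM /= -!norm_nrm cnormM. Qed.

Lemma nrm_cstar a : nrm (cmul (star a) a) = nrm a ^+ 2.
Proof. by apply/complexI; rewrite rmorphXn /= -!norm_nrm cstar_identity. Qed.

Lemma nrm_le_star a : nrm a <= nrm (star a).
Proof.
have := nrm_cmul (star a) a; rewrite nrm_cstar expr2.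
have := nrm_ge0 a; rewrite le_eqVlt => /predU1P[<- _|a0]; first exact: nrm_ge0.
by rewrite ler_pM2r.
Qed.

Lemma nrm_star a : nrm (star a) = nrm a.
Proof.
by apply/eqP; rewrite eq_le nrm_le_star andbT -{2}(starK a) nrm_le_star.
Qed.

End CStarTheory.

(** The pair [(a, l)] stands for [a + l 1]; [R[i]^o] is the field seen as a module over itself. *)
Definition unitization (R : realType) (A : cstarAlgType R) : Type :=
  (A * R[i]^o)%type.

Section UnitizationRing.
Variables (R : realType) (A : cstarAlgType R).
Local Notation B := (unitization A).

HB.instance Definition _ := GRing.Lmodule.copy B (A * R[i]^o)%type.

Definition umul (x y : B) : B :=
  (cmul x.1 y.1 + (y.2 *: x.1 + x.2 *: y.1), x.2 * y.2).

Let uone : B := (0, 1).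

Fact umulA : associative umul.
Proof.
move=> [a l] [b m] [c n]; congr (_, _); last exact: mulrA.
rewrite /= !cmulDl !cmulDr cmulA !cmulZl !cmulZr !scalerDr !scalerA.
by rewrite [n * m]mulrC [n * l]mulrC; zmod.
Qed.

Fact umul1l : left_id uone umul.
Proof.
move=> [a l]; congr (_, _) => /=; last exact: mul1r.
by rewrite cmul0l scaler0 scale1r !add0r.
Qed.

Fact umul1r : right_id uone umul.
Proof.
move=> [a l]; congr (_, _) => /=; last exact: mulr1.
by rewrite cmul0r scaler0 scale1r addr0 add0r.
Qed.

Fact umulDl : left_distributive umul +%R.
Proof.
move=> [a l] [b m] [c n]; congr (_, _); last exact: mulrDl.
by rewrite /= cmulDl scalerDr scalerDl; zmod.
Qed.

Fact umulDr : right_distributive umul +%R.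
Proof.
move=> [a l] [b m] [c n]; congr (_, _); last exact: mulrDr.
by rewrite /= cmulDr scalerDr scalerDl; zmod.
Qed.

Fact uone_neq0 : uone != 0.
Proof. by apply/eqP => -[] /eqP; rewrite oner_eq0. Qed.

HB.instance Definition _ := GRing.Zmodule_isNzRing.Build B
  umulA umul1l umul1r umulDl umulDr uone_neq0.

Fact uscalerAl (c : R[i]) (x y : B) : c *: (x * y) = (c *: x) * y.
Proof.
case: x y => [a l] [b m]; congr (_, _) => /=; last exact: mulrA.
by rewrite cmulZl !scalerDr !scalerA [c * m]mulrC.
Qed.

HB.instance Definition _ := GRing.Lmodule_isLalgebra.Build R[i] B uscalerAl.

Fact uscalerAr (c : R[i]) (x y : B) : c *: (x * y) = x * (c *: y).
Proof.
case: x y => [a l] [b m]; congr (_, _) => /=; last exact: mulrCA.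
by rewrite cmulZr !scalerDr !scalerA [l * c]mulrC.
Qed.

HB.instance Definition _ := GRing.Lalgebra_isAlgebra.Build R[i] B uscalerAr.

End UnitizationRing.

(** * The operator norm on the unitization *)

Section UnitizationNorm.
Variables (R : realType) (A : cstarAlgType R).
Local Notation B := (unitization A).
Implicit Types (x y : B) (a b : A).

Definition ustar x : B := (star x.1, Num.conj x.2).

Definition uact x b : A := cmul x.1 b + x.2 *: b.

(* The first condition makes this a norm even when A already has a unit. *)
Definition unit_bound x : set R :=
  [set t | nrm x.2 <= t /\ forall b, nrm (uact x b) <= t * nrm b].

Definition unit_norm x : R := inf (unit_bound x).

Lemma unit_bound_ge0 x t : unit_bound x t -> 0 <= t.
Proof. by move=> [+ _]; apply: le_trans; exact: nrmc_ge0. Qed.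

Lemma unit_boundD x : unit_bound x (nrm x.1 + nrm x.2).
Proof.
split=> [|b]; first by rewrite lerDr nrm_ge0.
apply: le_trans (nrmD _ _) _; rewrite nrmZ mulrDl lerD2r; exact: nrm_cmul.
Qed.

Lemma unit_norm_le x t : unit_bound x t -> unit_norm x <= t.
Proof.
by move=> xt; apply: ge_inf xt; exists 0 => s /unit_bound_ge0.
Qed.

(** The infimum is attained: each condition on [t] is a non-strict inequality, after division by
    [nrm b] when [b] is nonzero. *)
Lemma unit_bound_norm x : unit_bound x (unit_norm x).
Proof.
have ne : unit_bound x !=set0 by exists (nrm x.1 + nrm x.2); exact: unit_boundD.
split=> [|b]; first by apply: lb_le_inf => // t [].
have [->|/eqP /nrm_gt0 b0] := eqVneq b 0.
  by rewrite /uact cmul0r scaler0 addr0 nrm0 mulr0.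
rewrite -ler_pdivrMr//; apply: lb_le_inf => // t [_ /(_ b)].
by rewrite -ler_pdivrMr.
Qed.

Lemma unit_norm_ge0 x : 0 <= unit_norm x.
Proof. exact: unit_bound_ge0 (unit_bound_norm x). Qed.

Lemma unit_norm_ge2 x : nrm x.2 <= unit_norm x.
Proof. by have [] := unit_bound_norm x. Qed.

Lemma nrm_uact x b : nrm (uact x b) <= unit_norm x * nrm b.
Proof. by have [] := unit_bound_norm x. Qed.

Lemma unit_normD x y : unit_norm (x + y) <= unit_norm x + unit_norm y.
Proof.
apply: unit_norm_le; split=> [|b].
  by apply: le_trans (nrmcD _ _) _; apply: lerD; exact: unit_norm_ge2.
have -> : uact (x + y) b = uact x b + uact y b.
  by rewrite /uact cmulDl scalerDl; zmod.
by apply: le_trans (nrmD _ _) _; rewrite mulrDl; apply: lerD; exact: nrm_uact.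
Qed.

Lemma unit_normZ_le c x : unit_norm (c *: x) <= nrm c * unit_norm x.
Proof.
apply: unit_norm_le; split=> [|b].
  by rewrite nrmcM ler_wpM2l ?nrmc_ge0 ?unit_norm_ge2.
have -> : uact (c *: x) b = c *: uact x b.
  by rewrite /uact cmulZl scalerDr scalerA.
by rewrite nrmZ -mulrA ler_wpM2l ?nrmc_ge0 ?nrm_uact.
Qed.

Lemma unit_normZ c x : unit_norm (c *: x) = nrm c * unit_norm x.
Proof.
apply/eqP; rewrite eq_le unit_normZ_le /=.
have [->|c0] := eqVneq c 0.
  by rewrite (_ : nrm 0 = 0) ?mul0r ?unit_norm_ge0// /nrm normr0.
have nc : 0 < nrm c.
  rewrite lt_neqAle nrmc_ge0 andbT eq_sym; apply/eqP => /nrmc_eq0 /eqP.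
  by rewrite (negPf c0).
have := unit_normZ_le c^-1 (c *: x); rewrite scalerA mulVf// scale1r.
rewrite -(ler_pM2l nc) mulrA -nrmcM mulfV// (_ : nrm 1 = 1) ?mul1r//.
by rewrite /nrm normr1.
Qed.

Lemma unit_normM x y : unit_norm (x * y) <= unit_norm x * unit_norm y.
Proof.
apply: unit_norm_le; split=> [|b].
  by rewrite nrmcM; apply: ler_pM; rewrite ?nrmc_ge0 ?unit_norm_ge2.
have -> : uact (x * y) b = uact x (uact y b).
  rewrite /uact !cmulDl !cmulDr !cmulZl !cmulZr !scalerDr !scalerA cmulA.
  by zmod.
apply: le_trans (nrm_uact _ _) _; rewrite -mulrA.
by apply: ler_wpM2l; [exact: unit_norm_ge0|exact: nrm_uact].
Qed.

(** The root of [t] is a bound for [x]: the squared norm of [uact x b] is that of [star b] times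
    [uact (ustar x * x) b], hence at most [t * nrm b ^+ 2]. *)
Lemma unit_norm_le_star_mul x : unit_norm x ^+ 2 <= unit_norm (ustar x * x).
Proof.
set t := unit_norm (ustar x * x); have t0 : 0 <= t := unit_norm_ge0 _.
rewrite -[t]sqr_sqrtr// ler_sqr ?nnegrE ?unit_norm_ge0 ?sqrtr_ge0//.
apply: unit_norm_le; split=> [|b].
  rewrite -ler_sqr ?nnegrE ?nrmc_ge0 ?sqrtr_ge0// sqr_sqrtr//.
  rewrite expr2 -{1}nrmc_conj -nrmcM.
  exact: (unit_norm_ge2 (ustar x * x)).
rewrite -ler_sqr ?nnegrE ?nrm_ge0 ?mulr_ge0 ?nrm_ge0 ?sqrtr_ge0//.
rewrite exprMn sqr_sqrtr// -nrm_cstar.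
have -> : cmul (star (uact x b)) (uact x b) =
    cmul (star b) (uact (ustar x * x) b).
  rewrite /uact /= starD starM starZ !cmulDl !cmulDr !cmulZl !cmulZr !cmulA.
  by rewrite scalerA [_ * x.2]mulrC; zmod.
apply: le_trans (nrm_cmul _ _) _; rewrite nrm_star mulrC expr2 mulrA.
by apply: ler_wpM2r; [exact: nrm_ge0|exact: nrm_uact].
Qed.

Lemma ustar_involutive x : ustar (ustar x) = x.
Proof. by case: x => a l; rewrite /ustar /= starK conjCK. Qed.

Lemma unit_norm_le_star x : unit_norm x <= unit_norm (ustar x).
Proof.
have := le_trans (unit_norm_le_star_mul x) (unit_normM _ _).
have := unit_norm_ge0 x; rewrite le_eqVlt => /predU1P[<- _|x0].
  exact: unit_norm_ge0.
by rewrite expr2 ler_pM2r.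
Qed.

Lemma unit_norm_star x : unit_norm (ustar x * x) = unit_norm x ^+ 2.
Proof.
apply/eqP; rewrite eq_le unit_norm_le_star_mul andbT.
apply: le_trans (unit_normM _ _) _; rewrite expr2.
apply: ler_wpM2r; first exact: unit_norm_ge0.
by rewrite -{2}(ustar_involutive x) unit_norm_le_star.
Qed.

Definition uinj a : B := (a, 0).

(** For the lower bound let [a] act on [star a] and use the $C^*$-identity. *)
Lemma unit_norm_inj a : unit_norm (uinj a) = nrm a.
Proof.
apply/eqP; rewrite eq_le; apply/andP; split.
  apply: le_trans (unit_norm_le (unit_boundD _)) _ => /=.
  by rewrite (_ : nrm 0 = 0) ?addr0// /nrm normr0.
have [->|/eqP /nrm_gt0 a0] := eqVneq a 0.
  by rewrite nrm0 unit_norm_ge0.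
have := nrm_uact (uinj a) (star a).
rewrite /uact /= scale0r addr0 -{1}(starK a) nrm_cstar nrm_star expr2.
by rewrite ler_pM2r.
Qed.

Lemma unit_norm_eq0 x : unit_norm x = 0 -> x = 0.
Proof.
move=> x0; have x2 : x.2 = 0.
  by apply/nrmc_eq0/eqP; rewrite eq_le nrmc_ge0 andbT -x0 unit_norm_ge2.
have xE : x = uinj x.1 by rewrite /uinj -x2; case: (x).
have := unit_norm_inj x.1; rewrite -xE x0 => /esym/nrm_eq0 x1.
by rewrite xE x1.
Qed.

End UnitizationNorm.

(** * Sequential completeness of normed modules and of the complex numbers *)

Section SequentialCompleteness.
Variable R : realType.

Lemma nrm_scomplete (V : completeNormedModType R[i]) : scomplete (@nrm R V).
Proof.
move=> u uC; have uN x : `|x| = (nrm x)%:C :> R[i] := norm_nrm x.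
have epsE (e : R[i]) : 0 < e -> exists2 d : R, 0 < d & e = d%:C.
  case: e => a b; rewrite ltcE /= => /andP[/eqP-> a0].
  by exists a.
have : cvg (u @ \oo).
  apply: cauchy_cvg; apply: cauchy_exP => e /epsE[d d0 ->].
  have [n nP] := uC _ (divr_gt0 d0 (ltr0Sn _ 1)).
  exists (u n); exists n => // m /= nm.
  rewrite -ball_normE /= distrC uN ltcR.
  by apply: le_lt_trans (nP _ nm) _; rewrite ltr_pdivrMr//; lra.
move=> /cvg_ex[l /cvgrPdist_le ul]; exists l => e e0.
have e0' : 0 < e%:C :> R[i] by rewrite ltcR.
have [n _ nP] := ul _ e0'.
by exists n => m nm; have := nP m nm; rewrite /= distrC uN lecR.
Qed.

Lemma abs_scomplete : scomplete (fun t : R => `|t|).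
Proof.
move=> u uC.
have : cvg (u @ \oo).
  apply: cauchy_cvg; apply: cauchy_exP => e e0.
  have [n nP] := uC _ (divr_gt0 e0 (ltr0Sn _ 1)).
  exists (u n); exists n => // m /= nm.
  rewrite -ball_normE /= distrC.
  by apply: le_lt_trans (nP _ nm) _; rewrite ltr_pdivrMr//; lra.
move=> /cvg_ex[l /cvgrPdist_le ul]; exists l => e e0.
have [n _ nP] := ul _ e0.
by exists n => m nm; have := nP m nm; rewrite /= distrC.
Qed.

Lemma nrmcE (c : R[i]) : nrm c = Num.sqrt (complex.Re c ^+ 2 + complex.Im c ^+ 2).
Proof. by rewrite /nrm normc_def. Qed.

Lemma abs_Re_le (c : R[i]) : `|complex.Re c| <= nrm c.
Proof. by rewrite nrmcE -sqrtr_sqr ler_wsqrtr// lerDl sqr_ge0. Qed.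

Lemma abs_Im_le (c : R[i]) : `|complex.Im c| <= nrm c.
Proof. by rewrite nrmcE -sqrtr_sqr ler_wsqrtr// lerDr sqr_ge0. Qed.

Lemma nrmc_le (c : R[i]) : nrm c <= `|complex.Re c| + `|complex.Im c|.
Proof.
have s0 : 0 <= `|complex.Re c| + `|complex.Im c| by exact: addr_ge0.
rewrite -(ger0_norm s0).
rewrite nrmcE -[leRHS]sqrtr_sqr ler_wsqrtr// sqrrD !real_normK ?num_real//.
by rewrite -addrA lerD2l lerDr mulrn_wge0// mulr_ge0.
Qed.

Lemma nrmc_scomplete : scomplete (@nrm R R[i]).
Proof.
move=> u uC.
have [|a aP] := @abs_scomplete (fun n => complex.Re (u n)).
  move=> e /uC[n nP]; exists n => m /nP; apply: le_trans.
  by rewrite -raddfB; exact: abs_Re_le.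
have [|b bP] := @abs_scomplete (fun n => complex.Im (u n)).
  move=> e /uC[n nP]; exists n => m /nP; apply: le_trans.
  by rewrite -raddfB; exact: abs_Im_le.
exists (a +i* b) => e e0; have e2 : 0 < e / 2 by rewrite divr_gt0.
have [n nP] := aP _ e2; have [n' n'P] := bP _ e2.
exists (maxn n n') => m; rewrite geq_max => /andP[/nP h /n'P h'].
apply: le_trans (nrmc_le _) _; rewrite !raddfB /=; lra.
Qed.

End SequentialCompleteness.

Section UnitizationCStar.
Variables (R : realType) (A : cstarAlgType R).
Local Notation B := (unitization A).

Lemma unit_norm_scomplete : scomplete (@unit_norm R A).
Proof.
move=> u uC.
have [|l lP] := @nrmc_scomplete R (fun n => (u n).2).
  by move=> e /uC[n nP]; exists n => m /nP; apply: le_trans;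
     exact: (unit_norm_ge2 (u m - u n)).
(* The component in [A] is [x] minus the scalar [x.2]; both have norm at most [unit_norm x], whence
   the factor [2]. *)
have le1 (x : B) : nrm x.1 <= 2 * unit_norm x.
  have -> : nrm x.1 = unit_norm (x + (- x.2) *: 1).
    rewrite -unit_norm_inj; congr unit_norm; congr (_, _) => /=.
      by rewrite scaler0 addr0.
    by rewrite -[_ *: _]/(- x.2 * 1) mulr1 subrr.
  apply: le_trans (unit_normD _ _) _; rewrite unit_normZ.
  have -> : nrm (- x.2) = nrm x.2 by rewrite /nrm normrN.
  have := unit_norm_ge2 x; have := unit_norm_ge0 x.
  have : unit_norm (1 : B) <= 1.
    apply: unit_norm_le; split=> [|b]; first by rewrite /nrm normr1.
    by rewrite /uact /= cmul0l add0r scale1r mul1r.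
  have := unit_norm_ge0 (1 : B); nra.
have [|a aP] := @nrm_scomplete R A (fun n => (u n).1).
  move=> e e0; have [n nP] := uC _ (divr_gt0 e0 (ltr0Sn _ 1)).
  exists n => m /nP h; apply: le_trans (le1 (u m - u n)) _; lra.
exists (a, l) => e e0; have e2 : 0 < e / 2 by rewrite divr_gt0.
have [n nP] := aP _ e2; have [n' n'P] := lP _ e2.
exists (maxn n n') => m; rewrite geq_max => /andP[/nP h /n'P h'].
apply: le_trans (unit_norm_le (unit_boundD _)) _ => /=; lra.
Qed.

Lemma unitization_cstar : unital_cstar_norm (@ustar R A) (@unit_norm R A).
Proof.
split.
- exact: unit_normD.
- exact: unit_normZ.
- exact: unit_normM.
- exact: unit_norm_eq0.
- exact: unit_norm_star.
- by move=> [a l] [b m]; congr (_, _); [exact: starD|exact: rmorphD].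
- by move=> c [a l]; congr (_, _); [exact: starZ|exact: rmorphM].
- move=> [a l] [b m]; congr (_, _) => /=; last by rewrite mulrC rmorphM.
  by rewrite !starD !starZ starM [X in _ + X]addrC.
- exact: ustar_involutive.
- exact: unit_norm_scomplete.
Qed.

(** Positivity in [A] tested in the unitization. Unlike the form [cmul (star b) b], it is directly
    seen to be stable under sums. *)
Definition cpos (a : A) : Prop := upos (@ustar R A) (@unit_norm R A) (uinj a).

Lemma uinjD (a b : A) : uinj (a + b) = uinj a + uinj b.
Proof. by congr (_, _); rewrite addr0. Qed.

Lemma cposD a b : cpos a -> cpos b -> cpos (a + b).
Proof. by rewrite /cpos uinjD; exact: (uposD unitization_cstar). Qed.

Lemma cposZ (t : R) a : 0 <= t -> cpos a -> cpos (t%:C *: a).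
Proof.
move=> t0 /(uposZ unitization_cstar t0); rewrite /cpos; congr upos.
by congr (_, _); exact: mulr0.
Qed.

Lemma cpos0 : cpos 0.
Proof. exact: (upos0 unitization_cstar). Qed.

Lemma cpos_self_adj a : cpos a -> star a = a.
Proof. by move=> [/(congr1 fst)]. Qed.

Lemma cpos_star c : cpos (cmul (star c) c).
Proof.
have -> : cpos (cmul (star c) c) =
    upos (@ustar R A) (@unit_norm R A) (ustar (uinj c) * uinj c).
  congr upos; congr (_, _) => /=; first by rewrite rmorph0 !scale0r !addr0.
  by rewrite mulr0.
exact: (upos_star unitization_cstar).
Qed.

Lemma nrm_cposD a b : cpos a -> cpos b -> nrm a <= nrm (a + b).
Proof.
rewrite -(unit_norm_inj a) -(unit_norm_inj (a + b)) uinjD.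
exact: (unorm_uposD unitization_cstar).
Qed.

End UnitizationCStar.

(** * Positive functionals *)

Section States.
Variables (R : realType) (A : cstarAlgType R).
Implicit Types (a b : A) (t : R) (z : R[i]).

Definition contractive_pos (rho : A -> R[i]) : Prop :=
  [/\ forall a b, rho (a + b) = rho a + rho b,
      forall z a, rho (z *: a) = z * rho a,
      forall a, rho (star a) = Num.conj (rho a),
      forall a, nrm (rho a) <= nrm a
    & forall b, 0 <= rho (cmul (star b) b)].

Definition herm a : A := (2^-1)%:C *: (a + star a).

Lemma starZr t a : star (t%:C *: a) = t%:C *: star a.
Proof. by rewrite starZ conj_real. Qed.

Lemma herm_id a : star a = a -> herm a = a.
Proof.
move=> sa; rewrite /herm sa -mulr2n -[a *+ 2]scaler_nat scalerA.
by rewrite -(rmorph_nat (real_complex R)) -rmorphM mulVf ?scale1r ?pnatr_eq0.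
Qed.

Lemma nrm_herm a : nrm (herm a) <= nrm a.
Proof.
rewrite /herm nrmZr ?invr_ge0//.
by have := nrmD a (star a); rewrite nrm_star; lra.
Qed.

Lemma nrm_herm_sublinear : sublinear (fun a => nrm (herm a)).
Proof.
split=> [a b|t a t0] /=.
  have -> : herm (a + b) = herm a + herm b.
    by rewrite /herm starD !scalerDr; zmod.
  exact: nrmD.
rewrite -nrmZr; last exact: ltW.
by congr nrm; rewrite /herm starZr -scalerDr !scalerA mulrC.
Qed.

Lemma herm_i a : star a = a -> herm ('i *: a) = 0.
Proof. by move=> sa; rewrite /herm starZ sa conjCi scaleNr subrr scaler0. Qed.

Lemma ReiIm_scale z a :
  z *: a = (complex.Re z)%:C *: a + (complex.Im z)%:C *: ('i *: a).
Proof.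
rewrite scalerA -scalerDl; congr (_ *: _).
by rewrite -complexiE mulrC {1}[z]complexE.
Qed.

(** Apply [mazur_orlicz] to the norm of the self-adjoint part. The cone [K] asks that [f] be
    nonnegative on positive elements and at least [n] at [g]; the resulting real functional is then
    complexified. *)
Theorem cstar_state c : exists2 rho, contractive_pos rho
  & rho (cmul (star c) c) = (nrm c ^+ 2)%:C.
Proof.
pose g := cmul (star c) c; pose n := nrm g.
have pg : cpos g := cpos_star c.
have sg : star g = g := cpos_self_adj pg.
pose K := [set z : A * R | exists k t,
  [/\ cpos k, 0 <= t & z = (k + t%:C *: g, - (t * n))]].
have Kc : convex_cone K.
  split.
  - exists 0, 0; split; [exact: cpos0|exact: lexx|].
    by rewrite scale0r addr0 mul0r oppr0.
  - move=> _ _ [k [t [pk t0 ->]]] [l [s [pl s0 ->]]].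
    exists (k + l), (t + s); split; [exact: cposD|exact: addr_ge0|].
    by congr (_, _) => /=; [rewrite rmorphD scalerDl; zmod|ring].
  - move=> s _ s0 [k [t [pk t0 ->]]].
    exists (s%:C *: k), (s * t); split=> /=.
    + by apply: cposZ => //; exact: ltW.
    + by apply: mulr_ge0 => //; exact: ltW.
    + by congr (_, _); [rewrite scalerDr scalerA rmorphM|ring].
(* Compatibility of the cone with the norm amounts to [t * n <= nrm (k + t g)], which is
   monotonicity of the norm. *)
have pK (p : A * R) : K p -> 0 <= nrm (herm p.1) + p.2.
  move=> [k [t [pk t0 ->]]] /=.
  have ptg := cposZ t0 pg.
  rewrite herm_id; last exact/cpos_self_adj/cposD.
  by have := nrm_cposD ptg pk; rewrite addrC nrmZr// -/n subr_ge0.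
have [f [fD fZ fp fK]] := mazur_orlicz nrm_herm_sublinear Kc pK.
have f0 : f 0 = 0 by have := fD 0 0; rewrite addr0; lra.
have fN a : f (- a) = - f a by have := fD a (- a); rewrite subrr f0; lra.
have fZr t a : f (t%:C *: a) = t * f a.
  have [t0|t0|->] := ltrgtP t 0; last by rewrite scale0r f0 mul0r.
    have := fZ (- t) a; rewrite oppr_gt0 rmorphN scaleNr fN => /(_ t0); lra.
  exact: fZ.
have fi a : star a = a -> f ('i *: a) = 0.
  move=> sa; have := fp ('i *: a); have := fp (- ('i *: a)).
  rewrite fN -scalerN /= !herm_i ?starN ?sa// nrm0; lra.
have fpos a : cpos a -> 0 <= f a.
  move=> pa; have /fK /= : K (a, 0).
    by exists a, 0; split; rewrite // scale0r addr0 mul0r oppr0.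
  by rewrite oppr0.
have ii a : 'i *: ('i *: a) = - a.
  by rewrite scalerA -(expr2 'i) sqrCi scaleN1r.
(* The complex-linear functional with real part [f]. *)
pose rho a := (f a) +i* (- f ('i *: a)).
have rhoD a b : rho (a + b) = rho a + rho b.
  by rewrite /rho scalerDr !fD opprD.
have rhoZ z a : rho (z *: a) = z * rho a.
  case: z => x y; rewrite /rho.
  have -> : 'i *: ((x +i* y) *: a) = (x +i* y) *: ('i *: a).
    by rewrite !scalerA mulrC.
  rewrite (ReiIm_scale (x +i* y) a) (ReiIm_scale (x +i* y) ('i *: a)) /= ii scalerN.
  by rewrite !fD !fN !fZr; congr (_ +i* _); ring.
exists rho; last first.
  rewrite -/g /rho (fi _ sg) oppr0 -nrm_cstar; congr (_ +i* _).
  apply/eqP; rewrite eq_le; apply/andP; split.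
    by apply: le_trans (fp g) _; rewrite herm_id.
  have /fK /= : K (g, - n).
    exists 0, 1; split; [exact: cpos0|exact: ler01|].
    by rewrite scale1r add0r mul1r.
  by rewrite opprK.
split=> // [a|a|b]; last first.
  have pb := cpos_star b.
  by rewrite /rho (fi _ (cpos_self_adj pb)) oppr0 lecR fpos.
(* Rotate [a] by a scalar [w] of modulus [1] that makes [rho (w *: a)] equal to [r]; this real value
   is [f (w *: a)], which is at most [nrm a]. *)
- have [r0|r0] := eqVneq (nrm (rho a)) 0; first by rewrite r0 nrm_ge0.
  set r := nrm (rho a) in r0 *.
  pose w := Num.conj (rho a) * r^-1%:C.
  have rr : r * r^-1 = 1 by rewrite mulfV.
  have nr : 0 <= r by exact: nrmc_ge0.
  have nw : nrm w = 1.
    by rewrite /w nrmcM nrmc_conj nrm_real ger0_norm ?invr_ge0.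
  have rhow : rho (w *: a) = r%:C.
    rewrite rhoZ /w mulrAC [_ * rho a]mulrC -normCK norm_nrm -/r.
    by rewrite -rmorphXn -rmorphM expr2 mulfK.
  have <- : complex.Re (rho (w *: a)) = r by rewrite rhow.
  apply: le_trans (fp _) _; apply: le_trans (nrm_herm _) _.
  by rewrite nrmZ nw mul1r.
(* The difference of [b] and [star b] has self-adjoint part [0], so [f] vanishes on it. *)
- have fst_ b : f (star b) = f b.
    have := fp (b - star b); have := fp (star b - b).
    by rewrite !fD !fN /herm !starD !starN !starK !addrA !subrK !subrr
      scaler0 nrm0; lra.
  rewrite /rho fst_; congr (_ +i* _).
  have -> : 'i *: star a = - star ('i *: a) by rewrite starZ conjCi scaleNr opprK.
  by rewrite fN fst_ !opprK.
Qed.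

Lemma nrm_starD_le a b :
  nrm a ^+ 2 <= nrm (cmul (star a) a + cmul (star b) b).
Proof. by rewrite -nrm_cstar; apply: nrm_cposD; exact: cpos_star. Qed.

End States.

(** * The linking algebra *)

Section HilbertModuleTheory.
Variables (R : realType) (A : cstarAlgType R) (V : hilbertModType A).
Implicit Types (x y v : V) (a : A) (z w : A * V) (t : R).

Lemma inner0r x : inner x 0 = 0.
Proof. by rewrite -(scale0r (0 : V)) innerZr !scale0r. Qed.

Lemma inner0l x : inner 0 x = 0.
Proof. by rewrite -inner_star inner0r star0. Qed.

Lemma innerZl (c : R[i]) x y : inner (c *: x) y = Num.conj c *: inner x y.
Proof. by rewrite -inner_star innerZr starZ inner_star. Qed.

Lemma inner_actl x y a : inner (act x a) y = cmul (star a) (inner x y).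
Proof. by rewrite -inner_star inner_act starM inner_star. Qed.

Lemma nrm_inner x : nrm (inner x x) = nrm x ^+ 2.
Proof.
apply/complexI; rewrite rmorphXn /= -!norm_nrm hnormE.
by rewrite sqrtCK.
Qed.

Lemma nrm_act x a : nrm (act x a) <= nrm x * nrm a.
Proof.
rewrite -ler_sqr ?nnegrE ?mulr_ge0 ?nrm_ge0// -nrm_inner inner_act inner_actl.
apply: le_trans (nrm_cmul _ _) _.
have -> : (nrm x * nrm a) ^+ 2 = nrm (star a) * nrm (inner x x) * nrm a.
  by rewrite nrm_star nrm_inner; ring.
by apply: ler_wpM2r; [exact: nrm_ge0|exact: nrm_cmul].
Qed.

Lemma dsum_innerDr z w w' :
  dsum_inner z (w + w') = dsum_inner z w + dsum_inner z w'.
Proof. by rewrite /dsum_inner /= cmulDr innerDr; zmod. Qed.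

Lemma dsum_innerZr z (c : R[i]) w : dsum_inner z (c *: w) = c *: dsum_inner z w.
Proof. by rewrite /dsum_inner /= cmulZr innerZr scalerDr. Qed.

Lemma dsum_inner_star z w : star (dsum_inner z w) = dsum_inner w z.
Proof. by rewrite /dsum_inner starD starM starK inner_star. Qed.

Lemma dsum_norm_le z t : 0 <= t ->
  (dsum_norm z <= t) = (nrm (dsum_inner z z) <= t ^+ 2).
Proof.
move=> t0; rewrite /dsum_norm -[in LHS](ger0_norm t0) -sqrtr_sqr.
by rewrite ler_sqrt// sqr_ge0.
Qed.

Lemma nrm1_le_dsum_norm z : nrm z.1 <= dsum_norm z.
Proof.
rewrite /dsum_norm -[leLHS](ger0_norm (nrm_ge0 _)) -sqrtr_sqr ler_wsqrtr//.
have [b zb] := inner_pos z.2.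
by rewrite /dsum_inner zb; exact: nrm_starD_le.
Qed.

Definition lower x : A * V -> A * V :=
  blockop (fun=> 0) (fun=> 0) (rmap x) (fun=> 0).

Lemma lowerE x z : lower x z = (0, act x z.1).
Proof. by rewrite /lower /blockop /rmap !addr0. Qed.

Lemma lower_linear (c : R[i]) x y :
  lower (c *: x + y) = fun z => c *: lower x z + lower y z.
Proof.
apply/funext => z; rewrite !lowerE actDl actZl.
by congr (_, _); rewrite /= scaler0 addr0.
Qed.

Lemma compact_op0 : @compact_op R A V V (fun=> 0).
Proof.
split; first by exists (fun=> 0) => x y; rewrite inner0l inner0r.
move=> e e0; exists (fun=> 0).
  exists 0%N, (fun=> 0), (fun=> 0), (fun=> 0) => z.
  by rewrite big_ord0.
apply: (@le_lt_trans _ _ 0%:E); last by rewrite lte_fin.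
apply: ge_ereal_sup => _ [z _ <-]; by rewrite subrr nrm0.
Qed.

Lemma linking_lower x : linking (lower x).
Proof.
exists 0, x, 0, (fun=> 0); split; first exact: compact_op0.
apply/funext => z; rewrite /lower /blockop /Tmap /lmap cmul0l inner0l.
by [].
Qed.

Lemma linking_norm_lower x : nrm x <= 1 -> (linking_norm (lower x) <= 1%:E)%E.
Proof.
move=> x1; apply: ge_ereal_sup => _ [z z1 <-]; rewrite lee_fin.
rewrite dsum_norm_le// lowerE /dsum_inner /= cmul0r add0r nrm_inner.
rewrite ler_sqr ?nnegrE ?nrm_ge0//; apply: le_trans (nrm_act _ _) _.
by rewrite mulr_ile1 ?nrm_ge0//; apply: le_trans (nrm1_le_dsum_norm z) z1.
Qed.

Lemma dsum_norm_linking M z : (linking_norm M <= 1%:E)%E -> dsum_norm z <= 1 ->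
  dsum_norm (M z) <= 1.
Proof.
move=> M1 z1; rewrite -lee_fin; apply: le_trans M1.
by apply: ereal_sup_ubound; exists z.
Qed.

Lemma functional_norm_eq (phi : (A * V -> A * V) -> R[i]) r :
  (forall M, linking M -> (linking_norm M <= 1%:E)%E -> nrm (phi M) <= r) ->
  (forall s, (forall M, linking M -> (linking_norm M <= 1%:E)%E ->
     nrm (phi M) <= s) -> r <= s) ->
  functional_norm phi = r%:E.
Proof.
move=> ub lub; apply/eqP; rewrite eq_le; apply/andP; split.
  by apply: ge_ereal_sup => _ [M [LM M1] <-]; rewrite lee_fin ub.
have ubd M : linking M -> (linking_norm M <= 1%:E)%E ->
    ((nrm (phi M))%:E <= functional_norm phi)%E.
  by move=> LM M1; apply: ereal_sup_ubound; exists M.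
case: (functional_norm phi) ubd => [s||] ubd; last 2 first.
- by rewrite leey.
(* If the norm were [-oo], no [M] would be admissible, and [r - 1] would be an upper bound too. *)
- suff : r <= r - 1 by move=> rr; exfalso; lra.
  by apply: lub => M LM M1; have := ubd M LM M1; rewrite leeNy_eq.
by rewrite lee_fin; apply: lub => M LM M1; rewrite -lee_fin ubd.
Qed.

(** * Values of states at the corner operators *)

Section States.
Variable phi : (A * V -> A * V) -> R[i].
Hypothesis phiS : linking_state phi.

Lemma state_lower (c : R[i]) x y :
  phi (lower (c *: x + y)) = c * phi (lower x) + phi (lower y).
Proof.
by have [lin _ _] := phiS; rewrite lower_linear lin//; exact: linking_lower.
Qed.

Lemma state_lower0 : phi (lower 0) = 0.
Proof.
by have := state_lower (-1) 0 0; rewrite scaler0 addr0 mulN1r addNr.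
Qed.

Lemma state_lowerZ (c : R[i]) x : phi (lower (c *: x)) = c * phi (lower x).
Proof. by rewrite -[c *: x]addr0 state_lower state_lower0 addr0. Qed.

Lemma state_lower_le x : nrm (phi (lower x)) <= nrm x.
Proof.
have [->|/eqP /nrm_gt0 x0] := eqVneq x 0.
  by rewrite state_lower0 nrm0 /nrm normr0.
have ni : 0 <= (nrm x)^-1 by rewrite invr_ge0 ltW.
have y1 : nrm ((nrm x)^-1%:C *: x) <= 1.
  by rewrite nrmZr// mulVf// gt_eqF.
have : nrm (phi (lower ((nrm x)^-1%:C *: x))) <= 1.
  have [_ _ phi1] := phiS; rewrite -lee_fin -phi1; apply: ereal_sup_ubound.
  exists (lower ((nrm x)^-1%:C *: x)) => //.
  by split; [exact: linking_lower|exact: linking_norm_lower].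
by rewrite state_lowerZ nrmcM nrm_real ger0_norm// ler_pdivrMl// mulr1.
Qed.

End States.

Lemma state_le_numradius phi x : linking_state phi ->
  nrm (phi (lower x)) <= numradius x.
Proof.
move=> phiS; apply: ub_le_sup; last by exists phi.
by exists (nrm x) => _ [psi psiS <-]; exact: state_lower_le.
Qed.

(** The sign of [r] covers the case of an empty set of states, whose supremum is [0] by
    convention. *)
Lemma numradius_le x r : 0 <= r ->
  (forall phi, @linking_state R A V phi -> nrm (phi (lower x)) <= r) ->
  numradius x <= r.
Proof.
move=> r0 xr; rewrite /numradius; set S := (X in sup X).
have [ne|S0] := pselect (S !=set0).
  by apply: ge_sup => // _ [phi phiS <-]; exact: xr.
by rewrite sup_out// => -[].
Qed.

Lemma numradius_ge0 x : 0 <= numradius x.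
Proof.
rewrite /numradius; set S := (X in sup X).
have [[_ [phi phiS _]]|S0] := pselect (S !=set0); last by rewrite sup_out// => -[].
exact: le_trans (nrmc_ge0 _) (state_le_numradius x phiS).
Qed.

Lemma numradius_le_nrm x : numradius x <= nrm x.
Proof.
by apply: numradius_le => [|phi phiS]; [exact: nrm_ge0|exact: state_lower_le].
Qed.

Lemma numradiusD x y : numradius (x + y) <= numradius x + numradius y.
Proof.
apply: numradius_le => [|phi phiS]; first by rewrite addr_ge0 ?numradius_ge0.
rewrite -[x]scale1r state_lower// mul1r scale1r.
by apply: le_trans (nrmcD _ _) _; apply: lerD; exact: state_le_numradius.
Qed.

Lemma numradiusZ_le (c : R[i]) x : numradius (c *: x) <= nrm c * numradius x.
Proof.
apply: numradius_le => [|phi phiS].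
  by rewrite mulr_ge0 ?nrmc_ge0 ?numradius_ge0.
by rewrite state_lowerZ// nrmcM ler_wpM2l ?nrmc_ge0 ?state_le_numradius.
Qed.

Lemma numradiusZ (c : R[i]) x : numradius (c *: x) = nrm c * numradius x.
Proof.
apply/eqP; rewrite eq_le numradiusZ_le /=.
have [->|c0] := eqVneq c 0.
  by rewrite (_ : nrm 0 = 0) ?mul0r ?numradius_ge0// /nrm normr0.
have nc : 0 < nrm c.
  rewrite lt_neqAle nrmc_ge0 andbT eq_sym; apply/eqP => /nrmc_eq0 /eqP.
  by rewrite (negPf c0).
have := numradiusZ_le c^-1 (c *: x); rewrite scalerA mulVf// scale1r.
rewrite -(ler_pM2l nc) mulrA -nrmcM mulfV// (_ : nrm 1 = 1) ?mul1r//.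
by rewrite /nrm normr1.
Qed.

(* The form rho (inner z w) is positive semidefinite: expand it at z - u w with
   |u| = 1 and u rho (inner z w) = |rho (inner z w)|. *)
Lemma nrm_rho_inner_le1 (rho : A -> R[i]) z w : contractive_pos rho ->
  dsum_norm z <= 1 -> dsum_norm w <= 1 -> nrm (rho (dsum_inner z w)) <= 1.
Proof.
move=> [rhoD rhoZ rhoS rhoN rhoP] z1 w1.
pose q z w := rho (dsum_inner z w).
have qD p p' p'' : q p (p' + p'') = q p p' + q p p''.
  by rewrite /q dsum_innerDr rhoD.
have qZ (c : R[i]) p p' : q p (c *: p') = c * q p p'.
  by rewrite /q dsum_innerZr rhoZ.
have qS p p' : q p p' = Num.conj (q p' p) by rewrite /q -rhoS dsum_inner_star.
have q0 p : 0 <= q p p.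
  rewrite /q /dsum_inner rhoD; have [b ->] := inner_pos p.2.
  by rewrite addr_ge0.
have qE p : q p p = (nrm (q p p))%:C by rewrite -norm_nrm ger0_norm.
have q1 p : dsum_norm p <= 1 -> nrm (q p p) <= 1.
  rewrite dsum_norm_le// expr1n => p1.
  exact: le_trans (rhoN _) p1.
rewrite -/(q z w); set r := nrm (q z w).
have [->//|r0] := eqVneq r 0.
pose u := - (Num.conj (q z w) * r^-1%:C).
have uq : u * q z w = - r%:C.
  rewrite mulNr mulrAC [_ * q z w]mulrC -normCK norm_nrm -/r.
  by rewrite -rmorphXn -rmorphM expr2 mulfK.
have uu : u * Num.conj u = 1.
  rewrite -normCK normrN norm_nrm nrmcM nrmc_conj nrm_real.
  by rewrite ger0_norm ?invr_ge0 ?nrmc_ge0// mulfV// rmorph1 expr1n.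
have := q0 (z + u *: w).
(* Each cross term equals [- r] and the diagonal terms are at most [1], so nonnegativity gives
   [2 * r <= 2]. *)
have -> : q (z + u *: w) (z + u *: w) =
    (nrm (q z z) + nrm (q w w) - 2 * r)%:C.
  rewrite qD qZ (qS _ z) (qS _ w) !qD !qZ !rmorphD !rmorphM /= -!qS.
  rewrite mulrDr mulrCA.
  have -> : Num.conj u * q w z = - r%:C.
    by rewrite qS -rmorphM uq rmorphN /= conj_real.
  rewrite uq mulrA [_ * u]mulrC uu mul1r.
  move: (qE z) (qE w); set s := nrm (q z z); set t := nrm (q w w) => -> ->.
  by rewrite -!rmorphN -!rmorphD; congr (_%:C); ring.
rewrite lecR; have := q1 _ z1; have := q1 _ w1; lra.
Qed.

(** The squared norm of [act x h] is the norm of [h^3]. As [h] is self-adjoint of norm [1], so is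
    [h^4], and [h^4 = h h^3] gives the lower bound. *)
Lemma nrm_act_inner_self x : nrm x = 1 -> nrm (act x (inner x x)) = 1.
Proof.
move=> x1; set h := inner x x.
have h1 : nrm h = 1 by rewrite /h nrm_inner x1 expr1n.
have sh : star h = h by rewrite /h inner_star.
have hh1 : nrm (cmul h h) = 1 by rewrite -{1}sh nrm_cstar h1 expr1n.
apply/eqP; rewrite eq_le; apply/andP; split.
  by have := nrm_act x h; rewrite x1 h1 mulr1.
rewrite -(@ler_sqr _ 1) ?nnegrE ?nrm_ge0// expr1n -nrm_inner.
rewrite inner_actl inner_act sh -/h.
have := nrm_cmul h (cmul h (cmul h h)); rewrite h1 mul1r; apply: le_trans.
have shh : star (cmul h h) = cmul h h by rewrite starM sh.
by rewrite cmulA -{1}shh nrm_cstar hh1 expr1n.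
Qed.

(** * States obtained from vectors of the direct sum *)

Section VectorFunctional.
Variables (rho : A -> R[i]) (z : A * V).
Hypotheses (rhoC : contractive_pos rho) (z1 : dsum_norm z <= 1).

Definition vector_functional (M : A * V -> A * V) : R[i] :=
  rho (dsum_inner z (M z)).

Let fnorm : R := sup [set nrm (vector_functional M) |
  M in [set M | linking M /\ (linking_norm M <= 1%:E)%E]].

Let le_fnorm M : linking M -> (linking_norm M <= 1%:E)%E ->
  nrm (vector_functional M) <= fnorm.
Proof.
move=> LM M1; apply: ub_le_sup; last by exists M.
exists 1 => _ [N [LN N1] <-]; apply: nrm_rho_inner_le1 => //.
exact: dsum_norm_linking.
Qed.

Let fnorm_le r : (forall M, linking M -> (linking_norm M <= 1%:E)%E ->
  nrm (vector_functional M) <= r) -> fnorm <= r.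
Proof.
move=> h; apply: ge_sup => [|_ [M [LM M1] <-]]; last exact: h.
exists (nrm (vector_functional (lower 0))); exists (lower 0) => //.
split; first exact: linking_lower.
by apply: linking_norm_lower; rewrite nrm0.
Qed.

(** A nonzero value at [lower x] makes the norm of the functional positive. That norm is at most
    [1], so dividing by it can only increase the value. *)
Lemma vector_state x : nrm x <= 1 -> 0 < nrm (vector_functional (lower x)) ->
  exists2 phi, linking_state phi &
    nrm (vector_functional (lower x)) <= nrm (phi (lower x)).
Proof.
move=> x1 v0.
have vF : nrm (vector_functional (lower x)) <= fnorm.
  by apply: le_fnorm; [exact: linking_lower|exact: linking_norm_lower].
have F0 : 0 < fnorm by apply: lt_le_trans vF.
have F1 : fnorm <= 1.
  apply: fnorm_le => M LM M1; apply: nrm_rho_inner_le1 => //.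
  exact: dsum_norm_linking.
have Fi : 0 <= fnorm^-1 by rewrite invr_ge0 ltW.
pose phi M := fnorm^-1%:C * vector_functional M.
have nphi M : nrm (phi M) = fnorm^-1 * nrm (vector_functional M).
  by rewrite nrmcM nrm_real ger0_norm.
have [rhoD rhoZ _ _ rhoP] := rhoC.
exists phi; last by rewrite nphi ler_peMl ?nrmc_ge0// invf_ge1.
split.
- move=> c M N LM LN; rewrite /phi /vector_functional dsum_innerDr dsum_innerZr.
  by rewrite rhoD rhoZ; ring.
(* The adjoint relation turns the pairing of [z] with [Ms (M z)] into the inner square of [M z]. *)
- move=> M Ms LM LMs adj; rewrite /phi /vector_functional /= -adj.
  apply: mulr_ge0; first by rewrite lecR.
  rewrite /dsum_inner rhoD; have [b ->] := inner_pos (M z).2.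
  by apply: addr_ge0; exact: rhoP.
- apply: functional_norm_eq => [M LM M1|r hr].
    by rewrite nphi ler_pdivrMl// mulr1 le_fnorm.
  rewrite -(ler_pM2l F0) mulr1; apply: fnorm_le => M LM M1.
  by rewrite -ler_pdivrMl// -nphi; exact: hr.
Qed.

End VectorFunctional.

(* With h = inner x x and w = x h, of norm 1, use the vector (h, w) / sqrt 2 and
   a positive functional attaining the norm of inner w w. *)
Lemma half_le_numradius x : nrm x = 1 -> 2^-1 <= numradius x.
Proof.
move=> x1; set h := inner x x; pose w := act x h.
have w1 : nrm w = 1 := nrm_act_inner_self x1.
have h1 : nrm h = 1 by rewrite /h nrm_inner x1 expr1n.
have [c wc] := inner_pos w.
have [rho rhoC rhow] := cstar_state c.
have {}rhow : rho (inner w w) = 1.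
  by rewrite wc rhow -nrm_cstar -wc nrm_inner w1 expr1n.
pose s : R := Num.sqrt 2^-1.
have ss : s * s = 2^-1 by rewrite -expr2 sqr_sqrtr// invr_ge0.
pose z : A * V := s%:C *: (h, w).
have z1 : dsum_norm z <= 1.
  rewrite dsum_norm_le// expr1n /z dsum_innerZr -dsum_inner_star dsum_innerZr.
  rewrite starZr dsum_inner_star scalerA -rmorphM ss nrmZr ?invr_ge0//.
  apply: (@le_trans _ _ (2^-1 * 2)); last by rewrite mulVf.
  rewrite ler_pM2l ?invr_gt0//; apply: le_trans (nrmD _ _) _ => /=.
  by rewrite nrm_cstar h1 nrm_inner w1 expr1n.
(* The two factors [s] contribute [2^-1], and what remains is [rho (inner w w) = 1], because
   [lower x] sends the first entry [h] to [w]. *)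
have vE : vector_functional rho z (lower x) = (2^-1)%:C.
  rewrite /vector_functional lowerE /dsum_inner /= cmul0r add0r.
  have [_ rhoZ _ _ _] := rhoC.
  by rewrite actZr innerZr innerZl conj_real scalerA -rmorphM ss rhoZ rhow mulr1.
have v2 : nrm (vector_functional rho z (lower x)) = 2^-1.
  by rewrite vE nrm_real ger0_norm ?invr_ge0.
have [| |phi phiS] := @vector_state rho z rhoC z1 x.
- by rewrite x1.
- by rewrite v2 invr_gt0.
by rewrite v2 => /le_trans; apply; exact: state_le_numradius.
Qed.

Lemma half_nrm_le_numradius x : 2^-1 * nrm x <= numradius x.
Proof.
have [->|/eqP /nrm_gt0 x0] := eqVneq x 0; first by rewrite nrm0 mulr0 numradius_ge0.
have ni : 0 <= (nrm x)^-1 by rewrite invr_ge0 ltW.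
have := @half_le_numradius ((nrm x)^-1%:C *: x).
rewrite nrmZr// mulVf ?gt_eqF// numradiusZ nrm_real ger0_norm// => /(_ erefl).
by rewrite ler_pdivlMl// mulrC.
Qed.

End HilbertModuleTheory.

Theorem theorem2p5 (R : realType) (A : cstarAlgType R) (V : hilbertModType A)
    (hA : exists a : A, a <> 0) :
  is_norm (@numradius R A V) /\
  forall x : V, 2^-1 * nrm x <= numradius x /\ numradius x <= nrm x.
Proof.
split; last first.
  by move=> x; split; [exact: half_nrm_le_numradius|exact: numradius_le_nrm].
split.
- exact: numradius_ge0.
- move=> x; split=> [x0|->].
    (* Definiteness follows from the lower bound. *)
    apply/nrm_eq0/eqP; rewrite eq_le nrm_ge0 andbT.
    by have := half_nrm_le_numradius x; rewrite x0; lra.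
  by apply/eqP; rewrite eq_le numradius_ge0 andbT -(nrm0 V) numradius_le_nrm.
- exact: numradiusZ.
- exact: numradiusD.
Qed.
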